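(* Let $k$ be an algebraically closed field of characteristic $0$. Let $A$ be a local finite dimensional (commutative) Gorenstein $k$-algebra having Hilbert function $(1,5,5,1)$. Then $A$ is smoothable.
   Context: Algebras are commutative with unit. For a local finite dimensional $k$-algebra $(A,\mathfrak{m},k)$ the Hilbert function $h_A$ is the Hilbert function of the associated graded ring, $h_A(n)=\dim_k \mathfrak{m}^n/\mathfrak{m}^{n+1}$, written as the vector of its non-zero values; so $h_A=(1,5,5,1)$ means $h_A(0)=1$, $h_A(1)=5$, $h_A(2)=5$, $h_A(3)=1$ and $h_A(n)=0$ for $n\ge 4$ (in particular $\dim_k A=12$). The algebra $A$ is Gorenstein iff it is injective as an $A$-module. $A$ is not assumed to be graded. Smoothability: let $\mathcal{H}ilb_d\,\mathbb{P}^n$ be the Hilbert scheme parametrizing closed subschemes of $\mathbb{P}^n_k$ of length $d$, and let $\mathcal{H}ilb_d^\circ\,\mathbb{P}^n$ be its irreducible component that is the closure of the locus of smooth subschemes (i.e. $d$-tuples of distinct points). A subscheme $R=\operatorname{Spec}A\subseteq\mathbb{P}^n$ of length $d$ is smoothable if $[R]\in\mathcal{H}ilb_d^\circ\,\mathbb{P}^n$. This is independent of the embedding, and equivalent to the existence of an abstract smoothing of $A$, i.e. a flat family of (finite) $k$-algebras with general fiber smooth over $k$ and special fiber isomorphic to $A$; the algebra $A$ is called smoothable if this holds. An algebra with Hilbert function $(1,5,5,1)$ can be embedded in $\mathbb{A}^5_k\subseteq\mathbb{P}^5_k$. *)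

(* Defs.v *)
From HB Require Import structures.
From mathcomp Require Import all_boot all_order all_algebra all_field.
From mathcomp Require Import mpoly.

Set Implicit Arguments.
Unset Strict Implicit.
Unset Printing Implicit Defensive.

Import GRing.Theory.
Local Open Scope ring_scope.

(* In a finite dimensional commutative algebra every ideal is a k-subspace, so
   ideals are represented in {vspace A}. *)
Definition is_ideal (k : fieldType) (A : falgType k) (J : {vspace A}) : Prop :=
  forall a x : A, x \in J -> a * x \in J.

Definition is_maximal_ideal (k : fieldType) (A : falgType k)
    (J : {vspace A}) : Prop :=
  [/\ is_ideal J, J <> fullv
    & forall K : {vspace A}, is_ideal K -> (J <= K)%VS -> K = J \/ K = fullv].

Definition is_local (k : fieldType) (A : falgType k) (m : {vspace A}) : Prop :=
  is_maximal_ideal m /\ forall J : {vspace A}, is_maximal_ideal J -> J = m.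

(* The power 0 is the unit ideal A, and not the line k.1 given by expv. *)
Definition ideal_pow (k : fieldType) (A : falgType k) (m : {vspace A})
    (n : nat) : {vspace A} :=
  iter n (fun J : {vspace A} => (J * m)%VS) fullv.

(* dim (m^n / m^(n+1)); the subtraction does not truncate, as m^(n+1) is
   contained in m^n when m is an ideal. *)
Definition hilb_fun (k : fieldType) (A : falgType k) (m : {vspace A})
    (n : nat) : nat :=
  (\dim (ideal_pow m n) - \dim (ideal_pow m n.+1))%N.

Definition injective_module (R : nzRingType) (Q : lmodType R) : Prop :=
  forall (M N : lmodType R) (i : {linear M -> N}) (f : {linear M -> Q}),
    injective i -> exists g : {linear N -> Q}, forall x : M, g (i x) = f x.

Definition gorenstein (k : fieldType) (A : falgType k) : Prop :=
  @injective_module A A^o.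

(* The closure does not depend on the basis of V giving the coordinates. *)
Definition zariski_closure (k : fieldType) (V : vectType k) (Z : V -> Prop)
    (v : V) : Prop :=
  forall P : {mpoly k[\dim {: V}]},
    (forall z, Z z -> P.@[fun i => coord (vbasis {: V}) i z] = 0) ->
    P.@[fun i => coord (vbasis {: V}) i v] = 0.

(* The Grassmannian of codimension d subspaces of V is the quotient by GL_d of
   the space of surjective linear maps V -> k^d, a map being sent to its
   kernel.  That quotient map is continuous and open, so the Zariski closure of
   a set Z of subspaces consists of the kernels of the surjective maps lying in
   the closure of the preimage of Z. *)
Definition grass_frame (k : fieldType) (V : vectType k) (d : nat)
    (W : {vspace V}) (phi : 'Hom(V, 'rV[k]_d)) : Prop :=
  limg phi = fullv /\ lker phi = W.

Definition grass_closure (k : fieldType) (V : vectType k) (d : nat)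
    (Z : {vspace V} -> Prop) (W : {vspace V}) : Prop :=
  exists phi : 'Hom(V, 'rV[k]_d),
    grass_frame W phi /\
    zariski_closure
      (fun psi : 'Hom(V, 'rV[k]_d) => exists2 U, Z U & grass_frame U psi) phi.

(* Hilb_d P^n is embedded as a closed subscheme of the Grassmannian of
   codimension d subspaces of the space dhomog n.+1 k d of forms of degree d,
   a subscheme R being sent to the degree d part of its homogeneous ideal; the
   degree d is large enough, as the constant Hilbert polynomial d has Gotzmann
   number d.  Hence subsets of Hilb_d P^n and their closures are described in
   this Grassmannian. *)

(* Homogeneous coordinate vectors of d distinct points of P^n. *)
Definition distinct_points (k : fieldType) (n d : nat)
    (p : 'I_d -> 'rV[k]_n.+1) : Prop :=
  (forall i, p i != 0) /\
  (forall i j, i != j -> forall c : k, p i != c *: p j).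

(* k is meant to be algebraically closed: the smooth subschemes of length d are
   then the sets of d distinct k-points. *)
Definition hilb_smooth (k : fieldType) (n d : nat)
    (W : {vspace dhomog n.+1 k d}) : Prop :=
  exists2 p : 'I_d -> 'rV[k]_n.+1, distinct_points p &
    forall F : dhomog n.+1 k d,
      F \in W <-> forall i, (F : {mpoly k[n.+1]}).@[fun j => p i 0 j] = 0.

Definition hilb_circ (k : fieldType) (n d : nat)
    (W : {vspace dhomog n.+1 k d}) : Prop :=
  grass_closure d (@hilb_smooth k n d) W.

(* The closed embeddings Spec A -> A^n, given by the images x of the coordinate
   functions. *)
Definition affine_embedding (k : fieldType) (A : falgType k) (n : nat)
    (x : 'I_n -> A) : Prop :=
  forall a : A, exists p : {mpoly k[n]}, mmap (in_alg A) x p = a.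

(* The A-point (1 : x_0 : ... : x_(n-1)) of A^n in P^n. *)
Definition homog_coord (k : fieldType) (A : falgType k) (n : nat)
    (x : 'I_n -> A) (i : 'I_n.+1) : A :=
  if unlift ord0 i is Some j then x j else 1.

(* W is the point [Spec A] of Hilb_d P^n, for Spec A embedded in A^n in P^n
   through x: the forms of degree d vanishing on Spec A. *)
Definition hilb_point (k : fieldType) (A : falgType k) (n d : nat)
    (x : 'I_n -> A) (W : {vspace dhomog n.+1 k d}) : Prop :=
  forall F : dhomog n.+1 k d,
    F \in W <-> mmap (in_alg A) (homog_coord x) (F : {mpoly k[n.+1]}) = 0.

(* Up to a linear change of coordinates every finite subscheme of P^n lies in
   A^n (k being infinite), so only embeddings through A^n are considered; the
   condition does not depend on the embedding. *)
Definition smoothable (k : fieldType) (A : falgType k) : Prop :=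
  exists (n : nat) (x : 'I_n -> A)
         (W : {vspace dhomog n.+1 k (\dim {: A}%VS)}),
    [/\ affine_embedding x, hilb_point x W & hilb_circ W].

(* Main.v *)
Require Import Defs.
From HB Require Import structures.
From Stdlib Require Import Classical.
From mathcomp Require Import all_boot all_order all_algebra all_field.
From mathcomp Require Import mpoly ring.
Set Implicit Arguments.
Unset Strict Implicit.
Unset Printing Implicit Defensive.
Import GRing.Theory.
Local Open Scope ring_scope.

(* Embed Spec A in A^5 through x_1, ..., x_5 in m, and let lambda be a linear
   functional on A with nondegenerate form lambda (a b).  The ideal of Spec A is
   the radical of the form (p, q) |-> phi (p q), where phi p = lambda (p (x))
   vanishes in degrees at least 4.  For points a_1, ..., a_12 and nonzero weights
   w_i, the ideal of the points is the radical of the form given in the same way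
   by p |-> \sum_i w_i p (a_i), so it suffices to approximate phi by such
   functionals.

   Put L_i = (1, a_i) and T (w, a) = \sum_i w_i L_i (x) L_i (x) L_i.  We start
   from 12 points with \sum_i w_i L_i (x) L_i = 0 such that the differential of
   T is onto the symmetric tensors: up to scaling, the basis of k^6 and the
   columns of a conference matrix, normalised to lie in an affine chart.  There
   T is a cubic form in 5 variables.  By Hensel lifting, T can be prescribed in
   k[t] modulo any power of t along any path leaving that point.  Shrink the
   points by t^r and divide the weights by t^(3r): the moments of degree at
   least 4 tend to 0, and those of degree at most 3 can follow, modulo t^r, the
   pencil joining the initial cubic form to phi.  As r is arbitrary, every
   polynomial vanishing on smooth subschemes vanishes along the whole pencil, in
   particular at its end phi. *)

(** * Ideals of local algebras *)

Section Ideals.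
Variables (k : fieldType) (A : falgType k).
Implicit Types J K : {vspace A}.

Lemma principal_ideal (x : A) : is_ideal (limg (amulr x)).
Proof.
move=> a _ /memv_imgP [c _ ->]; apply/memv_imgP; exists (a * c); first exact: memvf.
by rewrite !lfunE /= mulrA.
Qed.

Lemma mem_principal_ideal (x : A) : x \in limg (amulr x).
Proof. by apply/memv_imgP; exists 1; rewrite ?memvf // lfunE /= mul1r. Qed.

Lemma addv_ideal J K : is_ideal J -> is_ideal K -> is_ideal (J + K)%VS.
Proof.
move=> Ji Ki a _ /memv_addP [x xJ [y yK ->]].
by rewrite mulrDr memv_add ?Ji ?Ki.
Qed.

Lemma ideal_full J : is_ideal J -> 1 \in J -> J = fullv.
Proof.
move=> Ji J1; apply/eqP; rewrite eqEsubv subvf; apply/subvP=> x _.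
by rewrite -[x]mulr1 Ji.
Qed.

Lemma mul_prodv_ideal J K : is_ideal J -> is_ideal (J * K)%VS.
Proof.
move=> Ji a; suff /subvP sub : (J * K <= amull a @^-1: (J * K))%VS.
  by move=> x /sub; rewrite -memv_preim lfunE.
apply/prodvP => u v uJ vK; rewrite -memv_preim lfunE /= mulrA.
by rewrite memv_mul // Ji.
Qed.

Lemma full_ideal : is_ideal {: A}%VS.
Proof. by move=> a x _; apply: memvf. Qed.

Lemma ideal_pow_ideal J n : is_ideal (ideal_pow J n).
Proof. by elim: n => [|n IHn]; [apply: full_ideal | apply: mul_prodv_ideal]. Qed.

Lemma ideal_pow1 J : is_ideal J -> ideal_pow J 1 = J.
Proof.
move=> Ji; apply/eqP; rewrite eqEsubv /=; apply/andP; split.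
  by apply/prodvP => u v _; apply: Ji.
by apply/subvP=> x xJ; rewrite -[x]mul1r memv_mul // memvf.
Qed.

Lemma ideal_powD J n i : is_ideal J ->
  (ideal_pow J n * ideal_pow J i.+1 <= ideal_pow J (n + i.+1))%VS.
Proof.
move=> Ji; elim: i => [|i IHi]; first by rewrite ideal_pow1 // addn1.
by rewrite [ideal_pow J i.+2]/= prodvA addnS [ideal_pow J (_).+1]/= prodvSl.
Qed.

Lemma sub_maximal_ideal J :
  is_ideal J -> J <> fullv -> exists2 K, is_maximal_ideal K & (J <= K)%VS.
Proof.
have [n] := ubnP (\dim {: A} - \dim J); elim: n J => // n IHn J ltn Ji Jp.
have [Jmax|Jnmax] := classic (is_maximal_ideal J); first by exists J.
have [K [Ki JK KJ Kp]] : exists K, [/\ is_ideal K, (J <= K)%VS, K <> J & K <> fullv].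
  apply: NNPP => H; apply: Jnmax; split=> // K Ki JK.
  have [->|KJ] := classic (K = J); first by left.
  have [->|Kp] := classic (K = fullv); first by right.
  by case: H; exists K.
have ltJK : (\dim J < \dim K)%N.
  rewrite ltn_neqAle (dimvS JK) andbT; apply/negP => /eqP dJK.
  by apply: KJ; apply/esym/eqP; rewrite eqEdim JK dJK leqnn.
have ltn' : (\dim {: A} - \dim K < n)%N.
  apply: leq_trans (ltnSE ltn); apply: ltn_sub2l => //.
  exact: leq_trans ltJK (dimvS (subvf K)).
have [M Mmax KM] := IHn K ltn' Ki Kp.
by exists M => //; apply: subv_trans KM.
Qed.

Section Local.
Variable m : {vspace A}.
Hypotheses (A_comm : commutative (@GRing.mul A)) (A_local : is_local m).

Lemma local_ideal : is_ideal m.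
Proof. by case: A_local => -[]. Qed.

Lemma local_proper : 1 \notin m.
Proof. by case: A_local => -[mi mp _] _; apply/negP => /(ideal_full mi). Qed.

Lemma local_unit a : a \in m -> exists b, b * (1 - a) = 1.
Proof.
move=> am; have [J1|Jn] := classic (limg (amulr (1 - a)) = fullv).
  have: 1 \in limg (amulr (1 - a)) by rewrite J1 memvf.
  by case/memv_imgP=> b _; rewrite lfunE /=; exists b.
have [K /(proj2 A_local) ->] := sub_maximal_ideal (@principal_ideal _) Jn.
move=> /subvP /(_ _ (mem_principal_ideal _)) am'.
by case/negP: local_proper; rewrite -[1](subrK a) memvD.
Qed.

(** Rather than counting generators, the proof excludes every ideal [K] strictly inside [J], by
    induction on the codimension of [K] in [J]; the case [K = 0] is the claim. *)
Lemma nakayama J : is_ideal J -> (J <= J * m)%VS -> J = 0%VS.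
Proof.
move=> Ji JJm.
suff main K : is_ideal K -> (K <= J)%VS -> K <> J -> False.
  have [//|J0] := classic (J = 0%VS); case: (main 0%VS); rewrite ?sub0v //.
    by move=> a x /[!memv0] /eqP ->; rewrite mulr0.
  by move/esym.
have [n] := ubnP (\dim J - \dim K); elim: n K => // n IHn K ltn Ki KJ nKJ.
have [JmK|] := classic (J * m <= K)%VS.
  by apply: nKJ; apply/eqP; rewrite eqEsubv KJ (subv_trans JJm).
(* If [x * a] is outside [K], adding it gives a larger ideal [K'] inside [J]. Either induction
   applies to [K'], or [K' = J]; then [x = y + c * (x * a)] with [y] in [K], and [x] is in [K]
   because [1 - c * a] is invertible. *)
move=> H; apply: H; apply/prodvP => x a xJ am.
apply: contraT => xaK; pose K' := (K + limg (amulr (x * a)%R))%VS.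
have K'i : is_ideal K' by apply: addv_ideal => //; apply: principal_ideal.
have xaK' : x * a \in K' by rewrite -[x * a]add0r memv_add ?mem0v ?mem_principal_ideal.
have ltKK' : (\dim K < \dim K')%N.
  rewrite ltn_neqAle dimvS ?addvSl // andbT; apply/negP => /eqP dKK'.
  case/negP: xaK; have /eqP-> : K == K' by rewrite eqEdim addvSl dKK' leqnn.
  exact: xaK'.
have K'J : (K' <= J)%VS.
  rewrite subv_add KJ; apply/subvP=> _ /memv_imgP [c _ ->].
  by rewrite lfunE /= [x * a]A_comm mulrA Ji.
have [eK'|nK'] := classic (K' = J); last first.
  case: (IHn K') => //; apply: leq_trans (ltnSE ltn).
  by apply: ltn_sub2l => //; apply: leq_trans ltKK' (dimvS K'J).
have : x \in K' by rewrite eK'.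
case/memv_addP => y yK [_ /memv_imgP [c _ ->]]; rewrite lfunE /= => ex.
have [b eb] := local_unit (local_ideal c am).
case/negP: xaK; rewrite A_comm Ki //.
have -> : x = b * y; last exact: Ki.
have -> : y = (1 - c * a) * x by rewrite mulrBl mul1r {1}ex [x * a]A_comm mulrA addrK.
by rewrite mulrA eb mul1r.
Qed.

Lemma ideal_pow_decr n : (ideal_pow m n.+1 <= ideal_pow m n)%VS.
Proof. by apply/prodvP=> u v ? _; rewrite A_comm ideal_pow_ideal. Qed.

End Local.
End Ideals.

(** * Gorenstein duality *)

Section Residue.
Variables (k : fieldType) (A : falgType k) (m : {vspace A}).
Hypotheses (A_comm : commutative (@GRing.mul A)) (A_local : is_local m).
Hypothesis dim_m : \dim {: A} = (\dim m).+1.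

Lemma scale1_local (c : k) : c *: 1 \in m -> c = 0.
Proof.
move=> cm; apply/eqP; apply: contraT => c0.
by case/negP: (local_proper A_local); rewrite -[1](scalerK c0) memvZ.
Qed.

Lemma residue_exists x : exists c : k, x - c *: 1 \in m.
Proof.
have: x \in (<[1]> + m)%VS.
  suff -> : (<[1]> + m)%VS = fullv by rewrite memvf.
  apply/eqP; rewrite eqEdim subvf dim_m ltn_neqAle dimvS ?addvSr // andbT.
  apply/negP => /eqP e; case/negP: (local_proper A_local).
  have -> : m = (<[1]> + m)%VS by apply/eqP; rewrite eqEdim addvSr e leqnn.
  by apply: (subvP (addvSl _ _)); apply: memv_line.
case/memv_addP => _ /vlineP [c ->] [y ym ->]; exists c.
by rewrite addrC addKr.
Qed.

Definition residue x : k := xchoose (residue_exists x).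

Lemma residueP x : x - residue x *: 1 \in m.
Proof. exact: (xchooseP (residue_exists x)). Qed.

Lemma residue_uniq x c : x - c *: 1 \in m -> residue x = c.
Proof.
move=> xc; apply/eqP; rewrite -subr_eq0; apply/eqP/scale1_local.
rewrite scalerBl -[_ - _]opprK opprB -[X in - (X + _)](subrK x) -addrA opprD opprB.
by rewrite memvB ?residueP // -?opprB ?opprK.
Qed.

Lemma residueD : {morph residue : x y / x + y}.
Proof.
move=> x y; apply: residue_uniq.
by rewrite scalerDl opprD addrACA memvD ?residueP.
Qed.

Lemma residueM : {morph residue : x y / x * y}.
Proof.
move=> x y; apply: residue_uniq; have mi := local_ideal A_local.
have -> : x * y - (residue x * residue y) *: 1
        = y * (x - residue x *: 1) + residue x *: (y - residue y *: 1).
  rewrite mulrBr -scalerAr mulr1 A_comm scalerBr scalerA.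
  by rewrite addrA subrK.
by rewrite memvD ?memvZ ?mi ?residueP.
Qed.

Lemma residue1 : residue 1 = 1.
Proof. by apply: residue_uniq; rewrite scale1r subrr mem0v. Qed.

(** A copy of [k] meant to carry the [A]-module structure of [A / m]: the simple module on which
    injectivity is tested. *)
Definition residue_field : Type := k.
HB.instance Definition _ := GRing.Zmodule.on residue_field.

Definition residue_scale (a : A) (c : residue_field) : residue_field := residue a * c.

Fact residue_scaleA a b v : residue_scale a (residue_scale b v) = residue_scale (a * b) v.
Proof. by rewrite /residue_scale residueM mulrA. Qed.
Fact residue_scale1 : left_id 1 residue_scale.
Proof. by move=> v; rewrite /residue_scale residue1 mul1r. Qed.
Fact residue_scaleDr : right_distributive residue_scale +%R.
Proof. by move=> a u v; rewrite /residue_scale mulrDr. Qed.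
Fact residue_scaleDl v : {morph residue_scale^~ v : a b / a + b}.
Proof. by move=> a b; rewrite /residue_scale residueD mulrDl. Qed.

HB.instance Definition _ := GRing.Zmodule_isLmodule.Build A residue_field
  residue_scaleA residue_scale1 residue_scaleDr residue_scaleDl.

Lemma residue_eq (x y : A) : (forall z, z \in m -> z * x = 0) -> y * x = residue y *: x.
Proof.
move=> sx; have /sx := residueP y; rewrite mulrBl -scalerAl mul1r.
by move/eqP; rewrite subr_eq0 => /eqP.
Qed.

(* Injectivity extends the A-linear map k a -> A sending a to b to a
   multiplication of A. *)
Lemma gorenstein_socle (a b : A) : gorenstein A -> a != 0 ->
  (forall z, z \in m -> z * a = 0) -> (forall z, z \in m -> z * b = 0) ->
  exists c : k, b = c *: a.
Proof.
move=> gor a0 sa sb.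
pose toA (s : A) (c : residue_field) : A^o := (c : k) *: s.
have toA_lin s : (forall z, z \in m -> z * s = 0) -> linear (toA s).
  move=> ss r u v; rewrite /toA -[r *: u]/(residue r * u : k).
  by rewrite scalerDl -scalerA -residue_eq //; last by move=> z /ss zs; rewrite -scalerAr zs scaler0.
pose i := GRing.isLinear.Build A residue_field A^o _ (toA a) (toA_lin a sa).
pose il : {linear residue_field -> A^o} := HB.pack (toA a) i.
pose f := GRing.isLinear.Build A residue_field A^o _ (toA b) (toA_lin b sb).
pose fl : {linear residue_field -> A^o} := HB.pack (toA b) f.
have il_inj : injective il.
  move=> u v e; have {}e : (u : k) *: a = (v : k) *: a by [].
  have : (u - v : k) *: a == 0 by rewrite scalerBl e subrr.
  by rewrite scaler_eq0 (negbTE a0) orbF subr_eq0 => /eqP.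
have [g Hg] := gor _ _ il fl il_inj.
have := Hg (1 : k); rewrite /= /toA !scale1r => <-.
have ga : g (a : A^o) = a * g 1.
  by rewrite -[in LHS](mulr1 a) -[a * 1]/(a *: (1 : A^o)) linearZ.
by exists (residue (g 1)); rewrite -residue_eq // ga A_comm.
Qed.

End Residue.

Lemma prodv_ind (k : fieldType) (A : falgType k) (U V : {vspace A}) (P : A -> Prop) :
  P 0 -> (forall a b, P a -> P b -> P (a + b)) ->
  (forall u v, u \in U -> v \in V -> P (u * v)) ->
  forall a, a \in (U * V)%VS -> P a.
Proof.
move=> P0 PD PM a; rewrite unlock => /coord_span ->; apply: big_ind => // i _.
move: (coord _ _ _) => c; rewrite -tnth_nth.
have /allpairsP [[u v] /= [uU vV ->]] := mem_tnth i (allpairs_tuple *%R (vbasis U) (vbasis V)).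
by rewrite scalerAl; apply: PM; rewrite ?memvZ ?vbasis_mem.
Qed.

(** * Generators and socle of a local algebra *)

Section Structure.
Variables (k : fieldType) (A : falgType k) (m : {vspace A}).
Hypotheses (A_comm : commutative (@GRing.mul A)) (A_local : is_local m).

Lemma commutative_mmapM n (x : 'I_n -> A) :
  {morph mmap (in_alg A) x : p q / p * q}.
Proof.
by have [] := @commr_mmap_is_multiplicative n k A x (in_alg A)
  (fun i y => A_comm y (x i)) (fun p u v => A_comm _ _).
Qed.

Lemma mmap1_ideal_pow n (x : 'I_n -> A) u :
  (forall i, x i \in m) -> mmap1 x u \in ideal_pow m (mdeg u).
Proof.
move=> xm; have [N] := ubnP (mdeg u); elim: N u => // N IHN u ltN.
have [->|u0] := eqVneq u 0%MM; first by rewrite mdeg0 memvf.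
have [i ui] : exists i, u i != 0%N.
  apply: NNPP => H; case/negP: u0; apply/eqP/mnmP => i.
  by rewrite mnm0E; apply: NNPP => ui; apply: H; exists i; apply/eqP.
have eu : u = (u - U_(i) + U_(i))%MM.
  apply/mnmP => j; rewrite mnmDE mnmBE mnm1E.
  by case: eqP => [<-|_]; rewrite ?subnK ?lt0n // subn0 addn0.
move: ltN; rewrite eu mdegD mdeg1 addn1 ltnS => ltN.
rewrite commr_mmap1_M; last by move=> j y; apply: A_comm.
by rewrite mmap1U; apply: memv_mul; [apply: IHN | apply: xm].
Qed.

(** Successive approximation: modulo [m^(i+2)], an element of [m^(i+1)] is a polynomial in the
    [x i], and nilpotency of [m] ends the process. *)
Lemma local_generators n N (x : 'I_n -> A) :
    \dim {: A} = (\dim m).+1 -> ideal_pow m N = 0%VS -> (forall i, x i \in m) ->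
    (m <= <<[seq x i | i : 'I_n]>> + ideal_pow m 2)%VS ->
  affine_embedding x.
Proof.
move=> dim_m mN xm mgen.
pose S a := exists p, mmap (in_alg A) x p = a.
have SM a b : S a -> S b -> S (a * b).
  by move=> [p <-] [q <-]; exists (p * q); rewrite commutative_mmapM.
have SD a b : S a -> S b -> S (a + b).
  by move=> [p <-] [q <-]; exists (p + q); rewrite mmapD.
have SC c : S (c *: 1) by exists c%:MP; rewrite mmapC.
have SZ c a : S a -> S (c *: a).
  by move=> Sa; rewrite -[a]mul1r scalerAl; apply: SM.
have S0 : S 0 by rewrite -(scale0r 1); apply: SC.
have mi := local_ideal A_local.
have Sx a : a \in <<[seq x i | i : 'I_n]>>%VS -> S a.
  move/coord_span=> ->; apply: (big_ind S) => // i _; apply: SZ.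
  have lti : (i < size [seq x j | j : 'I_n])%N by rewrite size_image.
  have /mapP [j _ ->] := mem_nth 0 lti; by exists 'X_j; rewrite mmapX mmap1U.
have lift_pow : forall i a, a \in ideal_pow m i.+1 ->
    exists2 s, S s & a - s \in ideal_pow m i.+2.
  elim=> [|i IHi] a.
    rewrite ideal_pow1 // => /(subvP mgen) /memv_addP [s /Sx Ss [b bm ->]].
    by exists s => //; rewrite addrC addKr.
  move: a; apply: prodv_ind => [|a1 a2 [s1 S1 H1] [s2 S2 H2]|u v um vm].
  - by exists 0; rewrite ?subr0 ?mem0v.
  - by exists (s1 + s2); [apply: SD | rewrite opprD addrACA memvD].
  have [s Ss us'] := IHi _ um.
  have [t St vt'] : exists2 t, S t & v - t \in ideal_pow m 2.
    have /memv_addP [t /Sx St [b bm ->]] := subvP mgen _ vm.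
    by exists t => //; rewrite addrC addKr.
  exists (s * t); first exact: SM.
  have -> : u * v - s * t = u * (v - t) + (u - s) * t.
    by rewrite mulrBr mulrBl addrA subrK.
  have tm : t \in m.
    rewrite -[t](subrK v) memvD // -opprB memvN //.
    by move: vt'; apply/subvP; rewrite -{2}(ideal_pow1 mi) ideal_pow_decr.
  apply: memvD; last by rewrite memv_mul.
  apply: (subvP (_ : (ideal_pow m i.+1 * ideal_pow m 2 <= _)%VS)).
    by have := ideal_powD i.+1 1 mi; rewrite addnS addn1.
  by rewrite memv_mul.
have Sm i a : a \in ideal_pow m i.+1 -> S a.
  have [j] := ubnP (N - i); elim: j i a => // j IHj i a ltj ai.
  have [s Ss as'] := lift_pow i a ai; rewrite -[a](subrK s); apply: SD => //.
  have [leNi|ltiN] := leqP N i.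
    suff -> : a - s = 0 by [].
    apply/eqP; rewrite -memv0 -mN; move: as'; apply/subvP.
    have : (N <= i.+2)%N by apply: leq_trans leNi _; rewrite -addn2 leq_addr.
    elim: i.+2 => [|e IHe]; first by rewrite leqn0 => /eqP->.
    rewrite leq_eqVlt => /orP [/eqP->//|/IHe]; apply: subv_trans.
    exact: ideal_pow_decr.
  apply: (IHj i.+1) => //; rewrite subnS -ltnS prednK ?subn_gt0 //.
move=> a; rewrite -/(S a) -[a](subrK (residue A_local dim_m a *: 1)).
apply: SD; last exact: SC.
by apply: (Sm 0%N); rewrite ideal_pow1 // residueP.
Qed.

Lemma local_generators_exist n N :
    \dim {: A} = (\dim m).+1 -> ideal_pow m N = 0%VS ->
    (\dim m - \dim (ideal_pow m 2))%N = n ->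
  exists2 x : 'I_n -> A, affine_embedding x & forall i, x i \in m.
Proof.
move=> dim_m mN dim_n; pose D := (m :\: ideal_pow m 2)%VS.
have m2m : (ideal_pow m 2 <= m)%VS.
  by rewrite -{2}(ideal_pow1 (local_ideal A_local)) ideal_pow_decr.
have dimD : \dim D = n.
  have := dimv_cap_compl m (ideal_pow m 2); rewrite (capv_idPr m2m) -/D => e.
  by rewrite -dim_n -e addKn.
pose x (i : 'I_n) := (vbasis D)`_i.
have xD i : x i \in D by rewrite vbasis_mem // mem_nth // size_tuple dimD.
have xm i : x i \in m by apply: (subvP (diffvSl _ _)) (xD i).
exists x => //; apply: (@local_generators n N) => //.
rewrite -{1}(addv_idPl m2m) -addv_diff; apply: addvS => //; rewrite -/D.
apply/subvP => a /coord_vbasis ->; apply: memv_suml => i _.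
apply: memvZ; apply: memv_span; apply/mapP.
by exists (cast_ord dimD i); rewrite ?mem_enum.
Qed.

(** The multiplier is taken in the highest power of [m] that does not annihilate [y]. *)
Lemma socle_multiple N y : ideal_pow m N = 0%VS -> y != 0 ->
  exists2 c, c * y != 0 & forall z, z \in m -> z * (c * y) = 0.
Proof.
move=> mN y0.
have: forall u, u \in ideal_pow m N -> u * y = 0.
  by rewrite mN => u /[!memv0] /eqP->; rewrite mul0r.
elim: N {mN} => [H|N IHN H]; first by move: (H 1 (memvf _)); rewrite mul1r => /eqP; rewrite (negbTE y0).
have [/IHN //|/not_all_ex_not [u H']] := classic (forall u, u \in ideal_pow m N -> u * y = 0).
have [uN uy] := imply_to_and _ _ H'; exists u; first exact/eqP.
by move=> z zm; rewrite mulrA [z * u]A_comm; apply: H; apply: memv_mul.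
Qed.

(** [lam] is the coordinate along a socle element [c0]. A non-zero [a] has a non-zero multiple in
    the socle, which is a line by [gorenstein_socle]; so [c0], where [lam] is 1, is a multiple of
    [a]. *)
Lemma gorenstein_functional N :
    gorenstein A -> \dim {: A} = (\dim m).+1 -> ideal_pow m N = 0%VS ->
  exists lam : {linear A -> k^o}, forall a, (forall b, lam (a * b) = 0) -> a = 0.
Proof.
move=> gor dim_m mN.
have [c0] := socle_multiple mN (oner_neq0 A); rewrite mulr1 => c0n c0s.
exists (coord [tuple c0] ord0 \o projv <[c0]>) => a Ha.
apply: contraTeq (eqxx (0 : k)) => a0.
have [c can cas] := socle_multiple mN a0.
have [e ec] := gorenstein_socle A_comm A_local dim_m gor can cas c0s.
have fc0 : free [tuple c0] by rewrite seq1_free.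
have := Ha (e *: c); rewrite /= -scalerAr A_comm -ec projv_id ?memv_line //.
by have /= -> := coord_free ord0 ord0 fc0; move/eqP; rewrite oner_eq0.
Qed.

End Structure.

(** * Zariski closure and one-parameter families *)

Section LinearHom.
Variables (k : fieldType) (V W : vectType k).

Definition hom_of_linear (g : V -> W) (gl : linear g) : 'Hom(V, W) :=
  linfun (HB.pack g (GRing.isLinear.Build k V W _ g gl) : {linear V -> W}).

Lemma hom_of_linearE g gl F : @hom_of_linear g gl F = g F.
Proof. by rewrite /hom_of_linear lfunE. Qed.

End LinearHom.

Section Congruences.
Variable k : fieldType.
Implicit Types D a b : {poly k}.

Lemma dvdp_subM D a a' b b' :
  D %| a - b -> D %| a' - b' -> D %| a * a' - b * b'.
Proof.
move=> ab ab'; have -> : a * a' - b * b' = a * (a' - b') + (a - b) * b'.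
  by rewrite mulrBr mulrBl addrA subrK.
by apply: dvdp_add; [apply: dvdp_mull | apply: dvdp_mulr].
Qed.

Lemma dvdp_sub_sum D (I : Type) (r : seq I) (F G : I -> {poly k}) :
  (forall i, D %| F i - G i) -> D %| \sum_(i <- r) F i - \sum_(i <- r) G i.
Proof.
by move=> FG; rewrite -sumrB; apply: (big_ind (fun a => D %| a)) => [|a b|i _]; by [rewrite dvdp0 | apply: dvdp_add | ].
Qed.

Lemma dvdp_sub_mmap D N (g h : 'I_N -> {poly k}) (P : {mpoly k[N]}) :
  (forall i, D %| g i - h i) -> D %| mmap polyC g P - mmap polyC h P.
Proof.
move=> gh; apply: dvdp_sub_sum => u; apply: dvdp_subM; first by rewrite subrr dvdp0.
apply: (big_ind2 (fun a b => D %| a - b)) => [|*|i _].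
- by rewrite subrr dvdp0.
- exact: dvdp_subM.
elim: (u i) => [|e IHe]; first by rewrite !expr0 subrr dvdp0.
by rewrite !exprS dvdp_subM.
Qed.

Lemma horner_mmap N (g : 'I_N -> {poly k}) (P : {mpoly k[N]}) t :
  (mmap polyC g P).[t] = P.@[fun i => (g i).[t]].
Proof.
rewrite mevalE /mmap horner_sum; apply: eq_bigr => u _.
rewrite hornerM hornerC /mmap1 horner_prod; congr (_ * _).
by apply: eq_bigr => i _; rewrite horner_exp.
Qed.

Lemma dvdXnP_eq0 (a : {poly k}) : (forall r, 'X^(r.+1) %| a) -> a = 0.
Proof.
move=> Ha; apply/eqP; apply: contraT => a0.
have := dvdp_leq a0 (Ha (size a)); rewrite size_polyXn => /ltnW.
by rewrite ltnn.
Qed.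

Lemma poly_eq0_char0 (a : {poly k}) :
  [pchar k] =i pred0 -> (forall t, a.[t] = 0) -> a = 0.
Proof.
move=> /pcharf0P char0 Ha; apply/eqP; apply: contraT => a0.
have inj : injective (fun i : nat => i%:R : k).
  suff main i j : (i <= j)%N -> i%:R = j%:R :> k -> i = j.
    by move=> i j e; case/orP: (leq_total i j) => /main H; [|apply: esym]; apply: H.
  move=> ij /eqP; rewrite eq_sym -subr_eq0 -natrB // char0 subn_eq0 => ji.
  by apply/eqP; rewrite eqn_leq ij.
have := @max_poly_roots _ _ [seq i%:R | i <- iota 0 (size a)] a0.
rewrite map_inj_uniq ?iota_uniq // size_map size_iota ltnn => -> //.
by apply/allP => _ /mapP [i _ ->]; apply/eqP.
Qed.

End Congruences.

Section Closure.
Variable k : fieldType.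
Hypothesis char0 : [pchar k] =i pred0.

(** If [P] vanishes on [Z], then [q] times [P] along [delta] vanishes at every [t], so [P] along
    [delta] is the zero polynomial. Since [gamma] agrees with such curves modulo every power of the
    variable, [P] along [gamma] is zero too, at all [t] and not only near 0. *)
Lemma zariski_closure_approx (U : vectType k) (Z : U -> Prop)
    (g : 'I_(\dim {: U}) -> {poly k}) (gamma : k -> U) :
    (forall t i, coord (vbasis {: U}) i (gamma t) = (g i).[t]) ->
    (forall r, exists h delta q,
       [/\ forall i, 'X^(r.+1) %| h i - g i,
           forall t i, coord (vbasis {: U}) i (delta t) = (h i).[t],
           q != 0 & forall t, q.[t] != 0 -> zariski_closure Z (delta t)]) ->
  forall t, zariski_closure Z (gamma t).
Proof.
move=> Hg Hr t P PZ.
suff P0 : mmap polyC g P = 0 by rewrite (meval_eq _ (Hg t)) -horner_mmap P0 horner0.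
apply: dvdXnP_eq0 => r; have [h [delta [q [hg Hh q0 Hq]]]] := Hr r.
suff h0 : mmap polyC h P = 0.
  by rewrite -[mmap _ _ _]subr0 -h0 -opprB dvdpNr dvdp_sub_mmap.
apply: (mulfI q0); rewrite mulr0; apply: poly_eq0_char0 => // s.
rewrite hornerM horner_mmap; have [->|qs] := eqVneq q.[s] 0; first by rewrite mul0r.
by have := Hq s qs P PZ; rewrite (meval_eq _ (Hh s)) => ->; rewrite mulr0.
Qed.

Section Frames.
Variables (V : vectType k) (d : nat).

Definition elementary_fun (l : 'I_(\dim {: V})) (j : 'I_d) (F : V) : 'rV[k]_d :=
  coord (vbasis {: V}) l F *: delta_mx 0 j.

Fact elementary_fun_linear l j : linear (elementary_fun l j).
Proof. by move=> c u v; rewrite /elementary_fun linearP scalerDl scalerA. Qed.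

Definition elementary_hom l j : 'Hom(V, 'rV[k]_d) :=
  hom_of_linear (elementary_fun_linear l j).

Lemma hom_decomp (psi : 'Hom(V, 'rV[k]_d)) :
  psi = \sum_(l < \dim {: V}) \sum_(j < d) psi ((vbasis {: V})`_l) 0 j *: elementary_hom l j.
Proof.
apply/lfunP => F; rewrite sum_lfunE {1}(coord_vbasis (memvf F)) linear_sum.
apply: eq_bigr => l _; rewrite sum_lfunE linearZ /= {1}[psi _]row_sum_delta scaler_sumr.
apply: eq_bigr => j _; rewrite scale_lfunE hom_of_linearE /elementary_fun !scalerA.
by rewrite mulrC.
Qed.

(** [zariski_closure] refers to coordinates in [vbasis]; expressing them linearly in the matrix
    entries shows that a family with polynomial entries is a polynomial curve. *)
Definition frame_coord (f : V -> 'I_d -> {poly k}) i : {poly k} :=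
  \sum_(l < \dim {: V}) \sum_(j < d) (coord (vbasis {: 'Hom(V, 'rV[k]_d)}) i (elementary_hom l j))%:P
     * f ((vbasis {: V})`_l) j.

Lemma horner_frame_coord f (psi : 'Hom(V, 'rV[k]_d)) t :
    (forall F j, psi F 0 j = (f F j).[t]) ->
  forall i, coord (vbasis {: 'Hom(V, 'rV[k]_d)}) i psi = (frame_coord f i).[t].
Proof.
move=> Hf i; rewrite [in LHS](hom_decomp psi) linear_sum horner_sum; apply: eq_bigr => l _.
rewrite linear_sum horner_sum; apply: eq_bigr => j _.
by rewrite linearZ /= hornerM hornerC Hf mulrC.
Qed.

Lemma frame_closure_approx (Z : 'Hom(V, 'rV[k]_d) -> Prop)
    (f : V -> 'I_d -> {poly k}) (gamma : k -> 'Hom(V, 'rV[k]_d)) :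
    (forall t F j, gamma t F 0 j = (f F j).[t]) ->
    (forall r, exists (h : V -> 'I_d -> {poly k}) (delta : k -> 'Hom(V, 'rV[k]_d)) (q : {poly k}),
       [/\ forall F j, 'X^(r.+1) %| h F j - f F j,
           forall t F j, delta t F 0 j = (h F j).[t],
           q != 0 & forall t, q.[t] != 0 -> zariski_closure Z (delta t)]) ->
  forall t, zariski_closure Z (gamma t).
Proof.
move=> Hf Hr; apply: (@zariski_closure_approx _ Z (frame_coord f)).
  by move=> t i; apply: horner_frame_coord.
move=> r; have [h [delta [q [hf Hh q0 Hq]]]] := Hr r.
exists (frame_coord h), delta, q; split=> // [i|t i].
  by do 2![apply: dvdp_sub_sum => ?]; rewrite -mulrBr dvdp_mull.
exact: horner_frame_coord.
Qed.

End Frames.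
End Closure.

(** * Twelve points with a surjective tangent map *)

Definition sym_tensor (k : Type) (n : nat) (T : 'I_n -> 'I_n -> 'I_n -> k) :=
  forall a b c, T a b c = T b a c /\ T a b c = T a c b.

(** The derivative of the tensor cube of [p] in the direction [u]. *)
Definition tangent_cube (k : pzRingType) (n : nat) (u p : 'I_n -> k) (a b c : 'I_n) : k :=
  u a * p b * p c + p a * u b * p c + p a * p b * u c.

(* A symmetric conference matrix: C ^ 2 = 5 I, hence
   5 \sum_i e_i (x) e_i = \sum_m (C e_m) (x) (C e_m). *)
Definition conference (i j : nat) : int :=
  nth 0%Z (nth [::] [:: [:: 0%Z; 1%Z; 1%Z; 1%Z; 1%Z; 1%Z];
              [:: 1%Z; 0%Z; 1%Z; (-1)%Z; (-1)%Z; 1%Z];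
              [:: 1%Z; 1%Z; 0%Z; 1%Z; (-1)%Z; (-1)%Z];
              [:: 1%Z; (-1)%Z; 1%Z; 0%Z; 1%Z; (-1)%Z];
              [:: 1%Z; (-1)%Z; (-1)%Z; 1%Z; 0%Z; 1%Z];
              [:: 1%Z; 1%Z; (-1)%Z; (-1)%Z; 1%Z; 0%Z]] i) j.
Local Notation C := conference.

(* The operations of int are used without going through the ring structures, as
   vm_compute is some twenty times slower on the generic ones. *)
Local Notation "x *z y" := (intRing.mulz x y) (at level 40).
Local Notation "x +z y" := (intZmod.addz x y) (at level 50).
Local Notation "-z y" := (intZmod.oppz y) (at level 35).

(* Coefficients of a right inverse, up to the factor 72, of the map sending
   (u_m) to the squarefree part of \sum_m tangent_cube (u_m) (C e_m); they were
   found as a combination of tensors invariant under the symmetries of C: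
   12 u_m = T(q, q, _) - T(q, q, q) q / 6 - T(e_m, q, q) e_m / 2, q = C e_m. *)
Definition conference_dual (m a x y z : nat) : int :=
  let D b := (a == x)%:Z *z C b y *z C b z +z (a == y)%:Z *z C b x *z C b z
             +z (a == z)%:Z *z C b x *z C b y in
  D m +z D m +z -z (C m a *z C m x *z C m y *z C m z) +z -z ( (m == a)%:Z *z D a).

Definition distinct3 (T : eqType) (i j l : T) := [&& i != j, i != l & j != l].

Definition sum6 (F : nat -> int) : int := F 0%N +z (F 1%N +z (F 2%N +z (F 3%N +z (F 4%N +z F 5%N)))).
Lemma sum6E (F : nat -> int) : \sum_(i < 6) F i = sum6 F.
Proof. by rewrite !big_ord_recl big_ord0 addr0. Qed.

Definition perm_delta (i j l x y z : nat) : int :=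
  ([&& x == i, y == j & z == l] + [&& x == i, y == l & z == j]
   + [&& x == j, y == i & z == l] + [&& x == j, y == l & z == i]
   + [&& x == l, y == i & z == j] + [&& x == l, y == j & z == i])%N%:Z.

(** The matrix of the tangent map at the columns of [C], composed with its candidate right inverse
    [conference_dual]. *)
Definition conference_gram (i j l x y z : nat) : int :=
  sum6 (fun m => conference_dual m i x y z *z (C m j *z C m l)
               +z conference_dual m j x y z *z (C m i *z C m l)
               +z conference_dual m l x y z *z (C m i *z C m j)).

Lemma all_iota6 (P : pred nat) : all P (iota 0 6) -> forall i : 'I_6, P i.
Proof. by move=> /allP H i; apply: H; rewrite mem_iota ltn_ord. Qed.

Lemma conference_gramE (i j l x y z : 'I_6) : distinct3 i j l -> distinct3 x y z ->
  conference_gram i j l x y z = 12%:Z * perm_delta i j l x y z.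
Proof.
have H : all (fun i => all (fun j => all (fun l => distinct3 i j l ==>
     all (fun x => all (fun y => all (fun z => distinct3 x y z ==>
       (conference_gram i j l x y z == Posz 12 *z perm_delta i j l x y z))
       (iota 0 6)) (iota 0 6)) (iota 0 6)) (iota 0 6)) (iota 0 6)) (iota 0 6).
  by vm_compute.
move=> ijl xyz; apply/eqP.
have /implyP /(_ ijl) H1 := all_iota6 (all_iota6 (all_iota6 H i) j) l.
by have /implyP /(_ xyz) := all_iota6 (all_iota6 (all_iota6 H1 x) y) z.
Qed.

Lemma sum_delta (R : pzSemiRingType) (I : finType) (s : I) (F : I -> R) :
  \sum_t F t * (t == s)%:R = F s.
Proof.
rewrite (bigD1 s) //= eqxx mulr1 big1 ?addr0 // => t /negbTE ->.
by rewrite mulr0.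
Qed.

Section Conference.
Variable k : fieldType.
Hypothesis char0 : [pchar k] =i pred0.

Lemma natf_neq0_char0 n : n.+1%:R != 0 :> k.
Proof. by move/pcharf0P: char0 => ->. Qed.

Definition conf (i j : 'I_6) : k := (C i j)%:~R.

Lemma conference_squarefree (E : 'I_6 -> 'I_6 -> 'I_6 -> k) : sym_tensor E ->
  exists u : 'I_6 -> 'I_6 -> k, forall i j l, distinct3 i j l ->
    \sum_m tangent_cube (u m) (conf m) i j l = E i j l.
Proof.
move=> Esym.
pose e (t : 'I_6 * 'I_6 * 'I_6) : k :=
  if distinct3 t.1.1 t.1.2 t.2 then E t.1.1 t.1.2 t.2 / 72%:R else 0.
pose u (m a : 'I_6) : k := \sum_t e t * (conference_dual m a t.1.1 t.1.2 t.2)%:~R.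
exists u => i j l ijl.
have -> : \sum_m tangent_cube (u m) (conf m) i j l
        = \sum_t e t * (conference_gram i j l t.1.1 t.1.2 t.2)%:~R.
  rewrite (eq_bigr (fun m : 'I_6 => \sum_t e t * (
      conference_dual m i t.1.1 t.1.2 t.2 * (C m j * C m l)
    + conference_dual m j t.1.1 t.1.2 t.2 * (C m i * C m l)
    + conference_dual m l t.1.1 t.1.2 t.2 * (C m i * C m j))%:~R)).
    rewrite exchange_big; apply: eq_bigr => t _.
    rewrite -mulr_sumr -rmorph_sum; congr (_ * _%:~R).
    exact: (sum6E (fun m => conference_dual m i t.1.1 t.1.2 t.2 * (C m j * C m l)
    + conference_dual m j t.1.1 t.1.2 t.2 * (C m i * C m l)
    + conference_dual m l t.1.1 t.1.2 t.2 * (C m i * C m j))).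
  move=> m _; rewrite /tangent_cube /u /conf !(mulr_sumr, mulr_suml) -!big_split /=.
  by apply: eq_bigr => t _; rewrite !(rmorphD, rmorphM) /=; ring.
have -> : \sum_t e t * (conference_gram i j l t.1.1 t.1.2 t.2)%:~R
   = 12%:R * \sum_t e t * (perm_delta i j l t.1.1 t.1.2 t.2)%:~R.
  rewrite mulr_sumr; apply: eq_bigr => -[[x y] z] _ /=.
  have [xyz|/negbTE nxyz] := boolP (distinct3 x y z).
    by rewrite conference_gramE // rmorphM /= mulrCA.
  by rewrite /e /= nxyz !mul0r mulr0.
have delta x y z : distinct3 x y z -> E x y z = E i j l ->
    \sum_t e t * [&& t.1.1 == x :> nat, t.1.2 == y :> nat & t.2 == z :> nat]%:R
    = E i j l / 72%:R.
  move=> xyz <-; have -> : E x y z / 72%:R = e (x, y, z) by rewrite /e /= xyz.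
  rewrite -[RHS]sum_delta; apply: eq_bigr => -[[x' y'] z'] _ /=.
  by rewrite !xpair_eqE andbA.
have [ij il jl] := and3P ijl.
have E12 a b c : E a b c = E b a c by case: (Esym a b c).
have E23 a b c : E a b c = E a c b by case: (Esym a b c).
rewrite (eq_bigr (fun t => 
   e t * [&& t.1.1 == i :> nat, t.1.2 == j :> nat & t.2 == l :> nat]%:R +
   e t * [&& t.1.1 == i :> nat, t.1.2 == l :> nat & t.2 == j :> nat]%:R +
   e t * [&& t.1.1 == j :> nat, t.1.2 == i :> nat & t.2 == l :> nat]%:R +
   e t * [&& t.1.1 == j :> nat, t.1.2 == l :> nat & t.2 == i :> nat]%:R +
   e t * [&& t.1.1 == l :> nat, t.1.2 == i :> nat & t.2 == j :> nat]%:R +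
   e t * [&& t.1.1 == l :> nat, t.1.2 == j :> nat & t.2 == i :> nat]%:R)); last first.
  by move=> t _; rewrite /perm_delta -[_%:~R]/(_%:R) !natrD !mulrDr.
have [ji li lj] : [/\ j != i, l != i & l != j] by split; rewrite eq_sym.
have e1 : E i l j = E i j l by rewrite E23.
have e2 : E j i l = E i j l by rewrite E12.
have e3 : E j l i = E i j l by rewrite E23 e2.
have e4 : E l i j = E i j l by rewrite E12 e1.
have e5 : E l j i = E i j l by rewrite E23 e4.
rewrite !big_split /= !delta /distinct3 ?ij ?il ?jl ?ji ?li ?lj //.
by field; rewrite !natf_neq0_char0.
Qed.

End Conference.

(** The formula of [homog_coord] over any semiring, so that it serves for scalars, for polynomials
    in t and for the variables ['X_j] alike. *)
Definition hcoord (R : pzSemiRingType) (n : nat) (x : 'I_n -> R) (i : 'I_n.+1) : R :=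
  if unlift ord0 i is Some j then x j else 1.

Lemma hcoord0 (R : pzSemiRingType) n (x : 'I_n -> R) : hcoord x ord0 = 1.
Proof. by rewrite /hcoord unlift_none. Qed.

Lemma hcoord_lift (R : pzSemiRingType) n (x : 'I_n -> R) j : hcoord x (lift ord0 j) = x j.
Proof. by rewrite /hcoord liftK. Qed.

(** * Linear changes of coordinates on cubic tensors *)

Section Transfer.
Variables (k : fieldType) (n : nat).
Implicit Types (g h : 'I_n -> 'I_n -> k) (T : 'I_n -> 'I_n -> 'I_n -> k).

Definition vec_act g (x : 'I_n -> k) a := \sum_b g a b * x b.

Definition tensor_act g T a b c :=
  \sum_(t : 'I_n * 'I_n * 'I_n) g a t.1.1 * g b t.1.2 * g c t.2 * T t.1.1 t.1.2 t.2.

Lemma sum_triple (A B D : 'I_n -> k) :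
  \sum_(t : 'I_n * 'I_n * 'I_n) A t.1.1 * B t.1.2 * D t.2
  = (\sum_x A x) * (\sum_x B x) * (\sum_x D x).
Proof.
rewrite -(pair_bigA _ (fun (s : 'I_n * 'I_n) z => A s.1 * B s.2 * D z)) /=.
rewrite -(pair_bigA _ (fun x y => \sum_z A x * B y * D z)) /=.
rewrite -mulrA mulr_suml; apply: eq_bigr => x _.
rewrite mulr_suml mulr_sumr; apply: eq_bigr => y _.
by rewrite !mulr_sumr; apply: eq_bigr => z _; rewrite mulrA.
Qed.

Lemma tensor_act_tangent g u p a b c :
  tensor_act g (tangent_cube u p) a b c = tangent_cube (vec_act g u) (vec_act g p) a b c.
Proof.
rewrite /tangent_cube /vec_act -!sum_triple -!big_split /=.
by apply: eq_bigr => t _; ring.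
Qed.

Lemma tensor_actK g h T :
  (forall a c, \sum_b g a b * h b c = (a == c)%:R) ->
  forall a b c, tensor_act g (tensor_act h T) a b c = T a b c.
Proof.
move=> gh a b c; rewrite /tensor_act.
under eq_bigr do rewrite mulr_sumr.
rewrite exchange_big /= -[RHS](sum_delta (a, b, c) (fun t => T t.1.1 t.1.2 t.2)).
apply: eq_bigr => -[[x y] z] _ /=; rewrite !xpair_eqE -!mulnb !natrM.
rewrite ![_ == a]eq_sym ![_ == b]eq_sym ![_ == c]eq_sym -!gh mulrC -sum_triple mulr_suml.
by apply: eq_bigr => t _; ring.
Qed.

Lemma tensor_act_sym g T : sym_tensor T -> sym_tensor (tensor_act g T).
Proof.
move=> Tsym a b c; split; rewrite /tensor_act.
  rewrite [RHS](reindex_inj (h := fun t : 'I_n * 'I_n * 'I_n => (t.1.2, t.1.1, t.2))) /=.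
    by apply: eq_bigr => t _; rewrite (proj1 (Tsym _ _ _)); ring.
  by move=> [[x y] z] [[x' y'] z'] /= [-> -> ->].
rewrite [RHS](reindex_inj (h := fun t : 'I_n * 'I_n * 'I_n => (t.1.1, t.2, t.1.2))) /=.
  by apply: eq_bigr => t _; rewrite (proj2 (Tsym _ _ _)); ring.
by move=> [[x y] z] [[x' y'] z'] /= [-> -> ->].
Qed.

End Transfer.

(* The six basis vectors with weight 5 and the six columns of C with weight -1;
   dividing by the sum of the coordinates puts these points in an affine chart. *)
Definition conf_point (s a : nat) : int :=
  if (s < 6)%N then (s == a)%:Z else C (s - 6) a.
Definition conf_weight (s : nat) : int := if (s < 6)%N then 5%:Z else (-1)%Z.
Definition conf_level (s : nat) : int := sum6 (conf_point s).

Definition sum12 (F : nat -> int) := sum6 F + sum6 (fun i => F (6 + i)%N).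

Lemma sum12E (F : nat -> int) : \sum_(i < 6 + 6) F i = sum12 F.
Proof. by rewrite big_split_ord /= sum6E (sum6E (fun i => F (6 + i)%N)). Qed.

Lemma all_iota12 (P : pred nat) : all P (iota 0 12) -> forall i : 'I_(6 + 6), P i.
Proof. by move=> /allP H i; apply: H; rewrite mem_iota ltn_ord. Qed.

(** The relation [5 I - C^2 = 0] for the symmetric matrix [C], checked by computation. *)
Lemma conf_point_isotropic (a b : 'I_6) :
  \sum_(s < 6 + 6) conf_weight s * (conf_point s a * conf_point s b) = 0.
Proof.
have H : all (fun a => all (fun b =>
    sum12 (fun s => conf_weight s * (conf_point s a * conf_point s b)) == 0)
  (iota 0 6)) (iota 0 6) by vm_compute.
rewrite (sum12E (fun s => conf_weight s * (conf_point s a * conf_point s b))).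
exact/eqP/(all_iota6 (all_iota6 H a) b).
Qed.

Lemma conf_level_neq0 (s : 'I_(6 + 6)) : conf_level s != 0.
Proof.
by apply: (all_iota12 (P := fun s => conf_level s != 0)); vm_compute.
Qed.

(** Cross-multiplied so as to stay in the integers: the points remain distinct after division by
    their levels. Coordinate 0 is left out, as it becomes 1 in the affine chart. *)
Lemma conf_point_distinct (s t : 'I_(6 + 6)) : s != t -> exists j : 'I_5,
  conf_point s (lift ord0 j) * conf_level t != conf_point t (lift ord0 j) * conf_level s.
Proof.
have H : all (fun s => all (fun t => (s != t) ==> has (fun j =>
    conf_point s j.+1 * conf_level t != conf_point t j.+1 * conf_level s) (iota 0 5))
  (iota 0 12)) (iota 0 12) by vm_compute.
have /implyP H' := all_iota12 (all_iota12 H s) t.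
move=> /H' /hasP [j]; rewrite mem_iota add0n => /andP [_ j5] Hj.
by exists (Ordinal j5); rewrite lift0.
Qed.

Section Configuration.
Variable k : fieldType.
Hypothesis char0 : [pchar k] =i pred0.

Lemma intr_eq0_char0 (z : int) : (z%:~R == 0 :> k) = (z == 0).
Proof.
have char := (pcharf0P k).1 char0.
case: z => n; first by rewrite -[_%:~R]/(n%:R) char.
by rewrite NegzE rmorphN /= oppr_eq0 -[_%:~R]/(n.+1%:R) char.
Qed.

Local Notation p := (fun (s : 'I_(6 + 6)) (a : 'I_6) => (conf_point s a)%:~R : k).
Local Notation v := (fun s : 'I_(6 + 6) => (conf_weight s)%:~R : k).

(** Tangents at the columns of [C] produce the squarefree entries of [E]. The remainder [R] is
    supported on repeated indices, and is reached by tangents at the basis vectors. *)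
Lemma conf_tangent_surj (E : 'I_6 -> 'I_6 -> 'I_6 -> k) : sym_tensor E ->
  exists u : 'I_(6 + 6) -> 'I_6 -> k, forall a b c,
    \sum_s v s * tangent_cube (u s) (p s) a b c = E a b c.
Proof.
move=> Esym; have [u1 Hu1] := conference_squarefree char0 Esym.
pose R a b c := E a b c - \sum_m tangent_cube (u1 m) (conf k m) a b c.
have R12 a b c : R a b c = R b a c.
  rewrite /R (proj1 (Esym a b c)); congr (_ - _); apply: eq_bigr => m _.
  by rewrite /tangent_cube; ring.
have R23 a b c : R a b c = R a c b.
  rewrite /R (proj2 (Esym a b c)); congr (_ - _); apply: eq_bigr => m _.
  by rewrite /tangent_cube; ring.
have R0 a b c : distinct3 a b c -> R a b c = 0 by move=> abc; rewrite /R Hu1 // subrr.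
(* With weight 5, the tangent at the basis vector [l] has entry [5 * u0 l j] at [(l, l, j)], and
   [15 * u0 l l] when [j = l]. The sign put on [u1] below cancels the weight -1. *)
pose u0 (l j : 'I_6) : k := if j == l then R l l l / 15%:R else R l l j / 5%:R.
exists (fun s => match split s with inl l => u0 l | inr m => fun a => - u1 m a end).
move=> a b c; rewrite big_split_ord /=.
have -> : \sum_(m < 6) v (rshift 6 m) * tangent_cube
     (match split (rshift 6 m) with inl l => u0 l | inr m => fun a => - u1 m a end)
     (p (rshift 6 m)) a b c
    = \sum_m tangent_cube (u1 m) (conf k m) a b c.
  apply: eq_bigr => m _; rewrite (unsplitK (inr m : 'I_6 + 'I_6)) /tangent_cube /conf /=.
  by rewrite /conf_weight /conf_point /= !addKn -[(-1)%Z%:~R]/(-1 : k); ring.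
apply/eqP; rewrite -subr_eq0 -addrA -opprB subr_eq0 -/(R a b c); apply/eqP.
have -> : \sum_(l < 6) v (lshift 6 l) * tangent_cube
     (match split (lshift 6 l) with inl l => u0 l | inr m => fun a => - u1 m a end)
     (p (lshift 6 l)) a b c
    = \sum_(l < 6) (5%:R * (l == b)%:R * (l == c)%:R * u0 l a
      + 5%:R * (l == a)%:R * (l == c)%:R * u0 l b + 5%:R * (l == a)%:R * (l == b)%:R * u0 l c).
  apply: eq_bigr => l _; rewrite (unsplitK (inl l : 'I_6 + 'I_6)) /tangent_cube /conf /=.
  rewrite /conf_weight /conf_point /= ltn_ord -![((l : nat) == _)%:~R]/((l == _)%:R).
  by rewrite -[5%:~R]/(5%:R : k); ring.
have tri (F : 'I_6 -> k) i j :
    \sum_(l < 6) 5%:R * (l == i)%:R * (l == j)%:R * F l = 5%:R * (i == j)%:R * F i.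
  rewrite -(sum_delta i (fun l => 5%:R * (l == j)%:R * F l)).
  by apply: eq_bigr => l _; ring.
rewrite !big_split /= !tri /u0.
have n5 := natf_neq0_char0 char0 4; have n15 := natf_neq0_char0 char0 14.
have tT : true%:R = 1 :> k by []; have fF : false%:R = 0 :> k by [].
have [<-{c}|bc] := eqVneq b c.
  have [<-{b}|ab] := eqVneq a b; rewrite tT; first by field; rewrite n15.
  by rewrite (R23 b b a) (R12 b a b) fF; field; rewrite n5.
have [eab|ab] := eqVneq a b.
  by rewrite -eab in bc *; rewrite (negbTE bc) [c == a]eq_sym (negbTE bc) tT fF; field; rewrite n5.
have [eac|ac] := eqVneq a c.
  by rewrite -eac (R23 a b a) tT fF; field; rewrite n5 n15.
have -> : R a b c = 0 by apply: R0; rewrite /distinct3 ab ac bc.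
by rewrite !fF; ring.
Qed.

(** [g] replaces coordinate 0 by the sum of all coordinates and [h] is its inverse: the chart where
    this sum is non-zero becomes the standard one. *)
Let g (a b : 'I_6) : k := if a == ord0 then 1 else (b == a)%:R.
Let h (a b : 'I_6) : k := if a == ord0 then (if b == ord0 then 1 else -1) else (b == a)%:R.

Lemma conf_act a (x : 'I_6 -> k) : a != ord0 -> vec_act g x a = x a.
Proof.
move=> a0; rewrite -[RHS](sum_delta a x) /vec_act /g (negbTE a0).
by apply: eq_bigr => b _; rewrite mulrC.
Qed.

Lemma conf_act0 s : vec_act g (p s) ord0 = (conf_level s)%:~R.
Proof.
rewrite /conf_level -sum6E rmorph_sum; apply: eq_bigr => b _.
by rewrite /g eqxx mul1r.
Qed.

Lemma conf_change_coord a c : \sum_b g a b * h b c = (a == c)%:R.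
Proof.
have [->|a0] := eqVneq a ord0; last first.
  rewrite -/(vec_act g (h^~ c) a) conf_act // /h (negbTE a0) eq_sym.
  by [].
rewrite big_ord_recl {1}/g eqxx mul1r {1}/h /=.
rewrite (eq_bigr (fun i : 'I_5 => (lift ord0 i == c)%:R)); last first.
  by move=> i _; rewrite /g eqxx mul1r /h -val_eqE /= eq_sym.
have [j ->|->] := unliftP ord0 c; last first.
  by rewrite eqxx big1 ?addr0 // => i _; rewrite -val_eqE.
rewrite -val_eqE /= (eq_bigr (fun i : 'I_5 => 1 * (i == j)%:R)); last first.
  by move=> i _; rewrite (inj_eq lift_inj) mul1r.
by rewrite (sum_delta j (fun=> 1)) addNr.
Qed.

Lemma isotropic_configuration : exists (w : 'I_12 -> k) (x : 'I_12 -> 'I_5 -> k),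
  [/\ forall s t, s != t -> exists j, x s j != x t j,
      forall b c, \sum_s w s * (hcoord (x s) b * hcoord (x s) c) = 0 &
      forall E, sym_tensor E -> exists u : 'I_12 -> 'I_6 -> k, forall a b c,
        \sum_s w s * tangent_cube (u s) (hcoord (x s)) a b c = E a b c].
Proof.
pose lev (s : 'I_(6 + 6)) : k := (conf_level s)%:~R.
have lev0 s : lev s != 0 by rewrite /lev intr_eq0_char0 conf_level_neq0.
pose x (s : 'I_(6 + 6)) (j : 'I_5) : k := p s (lift ord0 j) / lev s.
have hx s b : vec_act g (p s) b = lev s * hcoord (x s) b.
  have [j ->|->] := unliftP ord0 b; last by rewrite conf_act0 hcoord0 mulr1.
  by rewrite conf_act // hcoord_lift /x mulrC divfK.
(* Quadratic moments and [tangent_cube] are both quadratic in the point, so [lev s ^+ 2] offsets the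
   division of the point by [lev s]. *)
exists (fun s : 'I_(6 + 6) => v s * lev s ^+ 2), x; split.
- move=> s t /conf_point_distinct [j Hj]; exists j; apply: contra Hj => /eqP e.
  have Hp (r : 'I_(6 + 6)) : (conf_point r (lift ord0 j))%:~R = x r j * lev r by rewrite /x divfK.
  rewrite -subr_eq0 -intr_eq0_char0 rmorphB !rmorphM /= (Hp s) (Hp t) e -/(lev s) -/(lev t).
  by apply/eqP; ring.
- move=> b c; transitivity (\sum_s v s * (vec_act g (p s) b * vec_act g (p s) c)).
    by apply: eq_bigr => s _; rewrite !hx; ring.
  rewrite /vec_act; under eq_bigr do rewrite mulr_suml mulr_sumr.
  rewrite exchange_big big1 //= => y _.
  under eq_bigr do rewrite !mulr_sumr.
  rewrite exchange_big big1 //= => z _.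
  rewrite -[RHS](mulr0 (g b y * g c z)) -[in RHS](rmorph0 (intr : int -> k)).
  rewrite -(conf_point_isotropic y z) rmorph_sum mulr_sumr; apply: eq_bigr => s _.
  by rewrite !rmorphM /=; ring.
move=> E Esym; have [u Hu] := conf_tangent_surj (tensor_act_sym h Esym).
exists (fun s => vec_act g (u s)) => a b c.
rewrite -(tensor_actK E conf_change_coord a b c) {1}/tensor_act.
under [RHS]eq_bigr do rewrite -Hu mulr_sumr.
rewrite exchange_big; apply: eq_bigr => s _ /=.
transitivity (v s * tensor_act g (tangent_cube (u s) (p s)) a b c).
  by rewrite tensor_act_tangent /tangent_cube !hx; ring.
by rewrite /tensor_act mulr_sumr; apply: eq_bigr => t _; ring.
Qed.

End Configuration.

(** * Lifting along a pencil of functionals *)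

Section Hensel.
Variables (k : fieldType) (n d : nat) (w0 : 'I_d -> k) (x0 : 'I_d -> 'I_n -> k).
Hypothesis surj : forall E, sym_tensor E ->
  exists u : 'I_d -> 'I_n.+1 -> k, forall a b c,
    \sum_s w0 s * tangent_cube (u s) (hcoord (x0 s)) a b c = E a b c.

Definition cubes (R : pzSemiRingType) (w : 'I_d -> R) (x : 'I_d -> 'I_n -> R)
    (a b c : 'I_n.+1) : R :=
  \sum_s w s * (hcoord (x s) a * hcoord (x s) b * hcoord (x s) c).

Lemma dvdXp (p : {poly k}) : ('X %| p) = (p.[0] == 0).
Proof. by rewrite -['X]subr0 -polyC0 dvdp_XsubCl. Qed.

(** One power of t at a time: the error is a symmetric tensor, and surjectivity of the differential
    at [(w0, x0)] allows its leading coefficient to be cancelled. *)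
Lemma cubes_hensel (tau : 'I_n.+1 -> 'I_n.+1 -> 'I_n.+1 -> {poly k}) N :
    sym_tensor tau -> (forall a b c, (tau a b c).[0] = cubes w0 x0 a b c) ->
  exists (w : 'I_d -> {poly k}) (x : 'I_d -> 'I_n -> {poly k}),
    [/\ forall s, (w s).[0] = w0 s, forall s j, (x s j).[0] = x0 s j &
        forall a b c, 'X^(N.+1) %| cubes w x a b c - tau a b c].
Proof.
move=> tau_sym tau0; elim: N => [|N [w [x [Hw Hx Herr]]]].
  exists (fun s => (w0 s)%:P), (fun s j => (x0 s j)%:P); split=> [s|s j|a b c].
  - by rewrite hornerC.
  - by rewrite hornerC.
  rewrite expr1 dvdXp hornerD hornerN tau0 subr_eq0 horner_sum; apply/eqP/eq_bigr => s _.
  by rewrite !hornerM hornerC; congr (_ * (_ * _ * _));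
     rewrite /hcoord; case: unlift => [j|]; rewrite hornerC.
set Y : {poly k} := 'X^(N.+1).
have hx0 s a : (hcoord (x s) a).[0] = hcoord (x0 s) a.
  by rewrite /hcoord; case: unlift => [j|]; rewrite ?Hx // hornerC.
pose q a b c := (cubes w x a b c - tau a b c) %/ Y.
have qE a b c : cubes w x a b c = tau a b c + q a b c * Y.
  by rewrite divpK ?Herr // addrC subrK.
have cubes_sym : sym_tensor (cubes w x).
  by move=> a b c; split; apply: eq_bigr => s _; ring.
have [a b c|u Hu] := surj (E := fun a b c => - (q a b c).[0]).
  have [t1 t2] := tau_sym a b c; have [c1 c2] := cubes_sym a b c.
  by split; rewrite /q; [rewrite t1 c1 | rewrite t2 c2].
(* Rescaling the weights makes up for the component of u s that would move
   the point s out of the affine chart. *)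
pose al s a : {poly k} := (u s a - u s ord0 * hcoord (x0 s) a)%:P.
pose om s : {poly k} := (3%:R * w0 s * u s ord0)%:P.
pose w' s := w s + Y * om s.
pose x' s j := x s j + Y * al s (lift ord0 j).
have hx' s a : hcoord (x' s) a = hcoord (x s) a + Y * al s a.
  have [j ->|->] := unliftP ord0 a; first by rewrite !hcoord_lift.
  by rewrite !hcoord0 /al hcoord0 mulr1 subrr mulr0 addr0.
have Y0 : Y.[0] = 0 by rewrite hornerXn expr0n.
exists w', x'; split=> [s|s j|a b c].
- by rewrite hornerD hornerM Y0 mul0r addr0 Hw.
- by rewrite hornerD hornerM Y0 mul0r addr0 Hx.
(* The increment of the weighted cube of the point [s], divided by [Y]; only its value at t = 0
   matters. *)
pose st s :=
  let: (A, B, G) := (hcoord (x s) a, hcoord (x s) b, hcoord (x s) c) in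
  let: (a', b', c') := (al s a, al s b, al s c) in
  om s * A * B * G + w s * (a' * B * G + A * b' * G + A * B * c')
  + Y * (om s * (a' * B * G + A * b' * G + A * B * c')
         + w s * (a' * b' * G + a' * B * c' + A * b' * c')
         + Y * (om s * (a' * b' * G + a' * B * c' + A * b' * c') + w s * a' * b' * c'
                + Y * om s * a' * b' * c')).
have -> : cubes w' x' a b c - tau a b c = (q a b c + \sum_s st s) * Y.
  have -> : cubes w' x' a b c = cubes w x a b c + (\sum_s st s) * Y.
    rewrite mulr_suml -big_split /=; apply: eq_bigr => s _.
    by rewrite !hx' /w' /st; ring.
  by rewrite qE; ring.
rewrite [_ ^+ _.+2]exprS dvdp_mul //.
rewrite dvdXp hornerD horner_sum; apply/eqP.
(* The multiple of the point removed in [al] costs three times its cube, which [om] restores, so the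
   full tangent vector [u s] reappears. *)
transitivity ((q a b c).[0] + \sum_s w0 s * tangent_cube (u s) (hcoord (x0 s)) a b c).
  congr (_ + _); apply: eq_bigr => s _.
  rewrite /st /tangent_cube !(hornerD, hornerM) Y0 !hx0 Hw /om /al !hornerC; ring.
by rewrite Hu subrr.
Qed.

End Hensel.

Lemma mnm_split n (u : 'X_{1..n}) e : mdeg u = e.+1 ->
  exists i u', u = (U_(i) + u')%MM /\ mdeg u' = e.
Proof.
move=> ue; have [i ui] : exists i, u i != 0%N.
  apply/existsP; apply: contraPT ue => /existsPn H.
  rewrite (_ : u = 0%MM) ?mdeg0 //; apply/mnmP => i.
  by rewrite mnm0E; apply/eqP; rewrite -[_ == _]negbK H.
have eu : u = (U_(i) + (u - U_(i)))%MM.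
  apply/mnmP => j; rewrite mnmDE mnmBE mnm1E.
  by case: eqP => [<-|_]; rewrite ?subnKC ?lt0n // subn0.
exists i, (u - U_(i))%MM; split=> //; move: ue.
by rewrite {1}eu mdegD mdeg1 add1n => -[].
Qed.

(** Missing factors are supplied by coordinate 0 of [hcoord], which is 1; so the cubes of the
    vectors [(1, x)] encode all moments of degree at most 3. *)
Lemma mpolyX_low n (R : nzRingType) (u : 'X_{1..n}) : (mdeg u <= 3)%N ->
  exists a b c, 'X_[u] = hcoord (fun j => 'X_j) a * hcoord (fun j => 'X_j) b
                       * hcoord (fun j => 'X_j) c :> {mpoly R[n]}.
Proof.
have step (v : 'X_{1..n}) : v = 0%MM \/ exists i v', v = (U_(i) + v')%MM /\ mdeg v = (mdeg v').+1.
  case E: (mdeg v) => [|e]; first by left; apply/eqP; rewrite -mdeg_eq0 E.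
  by right; have [i [v' [-> <-]]] := mnm_split E; exists i, v'.
have h0 := hcoord0 (fun j => 'X_j : {mpoly R[n]}).
have hl := hcoord_lift (fun j => 'X_j : {mpoly R[n]}).
case: (step u) => [->|[i [u1 [-> ->]]]]; first by exists ord0, ord0, ord0; rewrite h0 !mulr1 mpolyX0.
case: (step u1) => [->|[j [u2 [-> ->]]]].
  by exists (lift ord0 i), ord0, ord0; rewrite h0 hl !mulr1 mpolyXD mpolyX0 mulr1.
case: (step u2) => [->|[l [u3 [-> ->]]]].
  by exists (lift ord0 i), (lift ord0 j), ord0; rewrite h0 !hl !mulr1 !mpolyXD mpolyX0 mulr1.
rewrite !ltnS leqn0 mdeg_eq0 => /eqP->.
by exists (lift ord0 i), (lift ord0 j), (lift ord0 l); rewrite !hl !mpolyXD mpolyX0 mulr1 mulrA.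
Qed.

Lemma mpolyX_high n (R : nzRingType) (u : 'X_{1..n}) : (4 <= mdeg u)%N ->
  exists a b c e u', 'X_[u] = 'X_a * 'X_b * 'X_c * 'X_e * 'X_[u'] :> {mpoly R[n]}.
Proof.
case E : (mdeg u) => [|[|[|[|N]]]] // _.
have [a [u1 [-> /mnm_split [b [u2 [-> /mnm_split [c [u3 [-> /mnm_split [e [u4 [-> _]]]]]]]]]]]] := mnm_split E.
by exists a, b, c, e, u4; rewrite !mpolyXD !mulrA.
Qed.

Section Moments.
Variables (k : fieldType) (n d : nat) (w0 : 'I_d -> k) (x0 : 'I_d -> 'I_n -> k).
Hypothesis isotropic : forall b c, \sum_s w0 s * (hcoord (x0 s) b * hcoord (x0 s) c) = 0.
Hypothesis surj : forall E, sym_tensor E ->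
  exists u : 'I_d -> 'I_n.+1 -> k, forall a b c,
    \sum_s w0 s * tangent_cube (u s) (hcoord (x0 s)) a b c = E a b c.

Definition moment (w : 'I_d -> {poly k}) (y : 'I_d -> 'I_n -> {poly k})
  (p : {mpoly k[n]}) : {poly k} := \sum_s w s * mmap polyC (y s) p.

Lemma moment_linear w y a p q :
  moment w y (a *: p + q) = a%:P * moment w y p + moment w y q.
Proof.
rewrite /moment mulr_sumr -big_split; apply: eq_bigr => s _.
by rewrite mmapD mmapZ mulrDr mulrCA.
Qed.

(** The initial cubic form applied to the degree 3 component of [p], which is extracted by scaling
    the points by t. *)
Definition cubic_part (p : {mpoly k[n]}) : k :=
  (moment (fun s => (w0 s)%:P) (fun s j => (x0 s j)%:P * 'X) p)`_3.

Lemma cubic_part_linear a p q :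
  cubic_part (a *: p + q) = a * cubic_part p + cubic_part q.
Proof. by rewrite /cubic_part moment_linear coefD coefCM. Qed.

Variable phi : {mpoly k[n]} -> k.
Hypothesis phi_linear : forall a p q, phi (a *: p + q) = a * phi p + phi q.
Hypothesis phi_high : forall u, (4 <= mdeg u)%N -> phi 'X_[u] = 0.

Definition pencil (p : {mpoly k[n]}) : {poly k} :=
  (1 - 'X) * (cubic_part p)%:P + 'X * (phi p)%:P.

Lemma pencil_linear a p q : pencil (a *: p + q) = a%:P * pencil p + pencil q.
Proof. by rewrite /pencil cubic_part_linear phi_linear !polyCD !polyCM; ring. Qed.

Local Notation H := (hcoord (fun j => 'X_j : {mpoly k[n]})).

Lemma mmap_hcoord (y : 'I_n -> {poly k}) a : mmap polyC y (H a) = hcoord y a.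
Proof. by rewrite /hcoord; case: unlift => [j|]; rewrite ?rmorph1 // mmapX mmap1U. Qed.

(* With points t ^ r x(t), the moments of degree at least 4 are negligible
   compared to t ^ (3 r), whereas those of degree at most 3 are prescribed
   through the tensor tau. *)
Lemma moment_approx r : exists (w : 'I_d -> {poly k}) (x : 'I_d -> 'I_n -> {poly k}),
  (forall s j, (x s j).[0] = x0 s j) /\
  forall p, 'X^(4 * r.+1) %| moment w (fun s j => 'X^(r.+1) * x s j) p - 'X^(3 * r.+1) * pencil p.
Proof.
(* Shrinking the points multiplies their homogeneous coordinates by [sg']. As
   [sg' a * sg a = 'X^(r.+1)], cubes equal to [tau] give the values ['X^(3 * r.+1) * pencil] to the
   moments of degree at most 3. *)
pose sg (a : 'I_n.+1) : {poly k} := if a == ord0 then 'X^(r.+1) else 1.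
pose sg' (a : 'I_n.+1) : {poly k} := if a == ord0 then 1 else 'X^(r.+1).
have sgsg' a : sg' a * sg a = 'X^(r.+1).
  by rewrite /sg /sg'; case: eqP; rewrite ?mul1r ?mulr1.
pose tau a b c := sg a * sg b * sg c * pencil (H a * H b * H c).
have tau_sym : sym_tensor tau.
  move=> a b c; rewrite /tau; split.
    by rewrite [sg a * sg b]mulrC [H a * H b]mulrC.
  by rewrite -!mulrA [sg b * (sg c * _)]mulrCA [H b * H c]mulrC.
have pencil0 p : (pencil p).[0] = cubic_part p.
  by rewrite /pencil hornerE !hornerM !hornerC hornerX mul0r addr0 hornerD hornerN hornerX hornerC subr0 mul1r.
have sg0 a : (sg a).[0] = (a != ord0)%:R.
  by rewrite /sg; case: eqP; rewrite ?hornerXn ?expr0n // hornerC.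
(* An index 0 makes [tau] vanish at t = 0, which matches the isotropy of the initial points; on the
   remaining indices [cubic_part] returns the cubes themselves. *)
have tau0 a b c : (tau a b c).[0] = cubes w0 x0 a b c.
  rewrite /tau !hornerM !sg0 pencil0 /cubes.
  have [i ->|->] := unliftP ord0 a; last first.
    rewrite eqxx !mul0r -[LHS](isotropic b c); apply: eq_bigr => s _.
    by rewrite hcoord0 mul1r.
  have [j ->|->] := unliftP ord0 b; last first.
    rewrite eqxx mulr0 !mul0r -[LHS](isotropic (lift ord0 i) c); apply: eq_bigr => s _.
    by rewrite hcoord0 mulr1.
  have [l ->|->] := unliftP ord0 c; last first.
    rewrite eqxx mulr0 mul0r -[LHS](isotropic (lift ord0 i) (lift ord0 j)).
    by apply: eq_bigr => s _; rewrite hcoord0 mulr1.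
  rewrite ![_ == ord0]eq_sym !neq_lift !mul1r /cubic_part /moment coef_sum.
  apply: eq_bigr => s _; rewrite coefCM !rmorphM /= !mmap_hcoord !hcoord_lift; congr (_ * _).
  rewrite (_ : _ * _ * _ = (x0 s i * x0 s j * x0 s l)%:P * 'X^3); last first.
    by rewrite !polyCM; ring.
  by rewrite coefCM coefXn eqxx mulr1.
have [w [x [_ Hx Hwx]]] := cubes_hensel surj (4 * r + 3) tau_sym tau0.
exists w, x; split=> //.
set y := fun s j => _ * x s j.
have hy s a : hcoord (y s) a = sg' a * hcoord (x s) a.
  have [j ->|->] := unliftP ord0 a; last by rewrite !hcoord0 /sg' eqxx mulr1.
  by rewrite !hcoord_lift /sg' eq_sym (negbTE (neq_lift _ _)).
have e4 : (4 * r + 3).+1 = (4 * r.+1)%N by rewrite -addnS mulnS addnC.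
apply: mpolyind => [|a u p _ _ Hp].
  have -> : (0 : {mpoly k[n]}) = -1 *: 0 + 0 by rewrite scaler0 addr0.
  by rewrite moment_linear pencil_linear polyCN polyC1 !mulN1r !addNr mulr0 subr0 dvdp0.
rewrite moment_linear pencil_linear mulrDr opprD addrACA dvdp_add //.
rewrite mulrCA -mulrBr dvdp_mull //; have [u3|u4] := leqP (mdeg u) 3.
  have [b [c [e ->]]] := @mpolyX_low n k u u3.
  have -> : moment w y (H b * H c * H e) - 'X^(3 * r.+1) * pencil (H b * H c * H e)
     = sg' b * sg' c * sg' e * (cubes w x b c e - tau b c e).
    rewrite mulrBr /tau; congr (_ - _).
      rewrite /cubes /moment mulr_sumr; apply: eq_bigr => s _.
      by rewrite !rmorphM /= !mmap_hcoord !hy; ring.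
    transitivity ((sg' b * sg b) * (sg' c * sg c) * (sg' e * sg e) * pencil (H b * H c * H e)).
      by rewrite !sgsg' -!exprD !mulSn mul0n addn0 addnA.
    by ring.
  by rewrite dvdp_mull // -e4.
(* In degree at least 4 both ends of the pencil vanish, while the moment carries four factors
   ['X^(r.+1)]. *)
have -> : pencil 'X_[u] = 0.
  have [b [c [e [f [v ev]]]]] := @mpolyX_high n k u u4.
  rewrite /pencil phi_high // mulr0 addr0 (_ : cubic_part _ = 0) ?mulr0 //.
  rewrite /cubic_part /moment coef_sum big1 // => s _; rewrite coefCM ev !rmorphM /=.
  rewrite !(mmapX, mmap1U) /=.
  set z := mmap1 _ _; rewrite (_ : _ * z =
    (x0 s b * x0 s c * x0 s e * x0 s f)%:P * z * 'X^4); last by rewrite !polyCM; ring.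
  by rewrite coefMXn mulr0.
rewrite mulr0 subr0; have [b [c [e [f [v ->]]]]] := @mpolyX_high n k u u4.
apply: (big_ind (fun p => _ %| p)) => [|p1 p2|s _]; [by rewrite dvdp0 | exact: dvdp_add |].
rewrite dvdp_mull // !rmorphM /= !(mmapX, mmap1U) dvdp_mulr // /y.
set Z := (X in _ %| X).
have -> : Z = 'X^(4 * r.+1) * (x s b * x s c * x s e * x s f); last by rewrite dvdp_mulIl.
rewrite /Z (_ : 4 * r.+1 = r.+1 + r.+1 + r.+1 + r.+1)%N; last by rewrite !mulSn mul0n addn0 !addnA.
by rewrite !exprD; ring.
Qed.

End Moments.

(** * Frames of finite subschemes *)

Section SmoothFrames.
Variables (k : fieldType) (n d : nat).
Hypothesis char0 : [pchar k] =i pred0.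
Local Notation V := (dhomog n.+1 k d).

Definition smooth_frame (psi : 'Hom(V, 'rV[k]_d)) : Prop :=
  exists2 U, @hilb_smooth k n d U & grass_frame U psi.

Variable a : 'I_d -> 'I_n -> k.
Hypothesis a_distinct : forall s t, s != t -> exists j, a s j != a t j.

Definition point_eval (F : V) : 'rV[k]_d := \row_s (F : {mpoly k[n.+1]}).@[hcoord (a s)].

Fact point_eval_linear : linear point_eval.
Proof. by move=> c u v; apply/rowP => s; rewrite !mxE (mpoly_of_dhomog_is_linear c u v) mevalD mevalZ. Qed.

Let ev := hom_of_linear point_eval_linear.

(** A product of one linear form per point, hence of degree exactly [d]. The form of [t] vanishes at
    [t] and not at [s]; for [t = s] the [pick] fails and gives ['X_ord0], which is 1 at all the
    points. *)
Lemma interpolating_form s : exists2 F : V,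
  (F : {mpoly k[n.+1]}).@[hcoord (a s)] != 0 &
  forall t, t != s -> (F : {mpoly k[n.+1]}).@[hcoord (a t)] = 0.
Proof.
pose l t : {mpoly k[n.+1]} := if [pick j | a s j != a t j] is Some j
  then 'X_(lift ord0 j) - a t j *: 'X_ord0 else 'X_ord0.
have lhom t : l t \is 1.-homog.
  have X1 i : ('X_i : {mpoly k[n.+1]}) \is 1.-homog by rewrite dhomogX /= mdeg1.
  by rewrite /l; case: pickP => [j _|_] //; rewrite rpredB ?rpredZ.
pose F := \prod_t l t.
have Fhom : F \is d.-homog.
  rewrite /F -[X in X.-homog]card_ord -sum1_card.
  apply: (big_ind2 (fun e (p : {mpoly k[n.+1]}) => p \is e.-homog)) => //.
    exact: dhomog1.
  by move=> ? ? ? ?; apply: dhomogM.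
exists (DHomog Fhom) => [|t ts] /=; rewrite /F rmorph_prod /=.
  apply/prodf_neq0 => t _; rewrite /l; case: pickP => [j aj|_].
    by rewrite mevalB mevalZ !mevalXU hcoord_lift hcoord0 mulr1 subr_eq0.
  by rewrite mevalXU hcoord0 oner_neq0.
apply/eqP/prodf_eq0; exists t => //; rewrite /l; case: pickP => [j _|none].
  by rewrite mevalB mevalZ !mevalXU hcoord_lift hcoord0 mulr1 subrr.
have [j aj] := a_distinct ts; have := none j.
by rewrite eq_sym aj.
Qed.

Lemma limg_point_eval : limg ev = fullv.
Proof.
apply/eqP; rewrite eqEsubv subvf; apply/subvP => v _.
rewrite (row_sum_delta v); apply: memv_suml => s _; apply: memvZ.
have [F Fs Ft] := interpolating_form s.
rewrite (_ : delta_mx 0 s = ev (((F : {mpoly k[n.+1]}).@[hcoord (a s)])^-1 *: F)).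
  exact: memv_img (memvf _).
apply/rowP => t; rewrite linearZ /= hom_of_linearE !mxE /=.
have [->|ts] := eqVneq t s; first by rewrite mulVf.
by rewrite (Ft t ts) mulr0.
Qed.

Lemma smooth_frame_unitmx (G : 'M[k]_d) (psi : 'Hom(V, 'rV[k]_d)) :
  G \in unitmx -> (forall F, psi F = point_eval F *m G) -> smooth_frame psi.
Proof.
move=> Gu Hpsi; have lk : lker psi = lker ev.
  apply/vspaceP => F; rewrite !memv_ker Hpsi hom_of_linearE.
  by rewrite -[0 in LHS](mul0mx _ G) (inj_eq (can_inj (mulmxK Gu))).
exists (lker ev); last first.
  split=> //; apply/eqP; rewrite eqEdim subvf.
  have := limg_ker_dim psi fullv; have := limg_ker_dim ev fullv.
  rewrite !capfv lk limg_point_eval => e1 e2.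
  by have /addnI -> := etrans e2 (esym e1); rewrite /= leqnn.
exists (fun s => \row_j hcoord (a s) j).
  split=> [s|s t st c].
    apply/eqP => /rowP /(_ ord0); rewrite !mxE hcoord0; apply/eqP; exact: oner_neq0.
  apply/eqP => /rowP e; have := e ord0; rewrite !mxE !hcoord0 mulr1 => c1.
  have [j] := a_distinct st; have := e (lift ord0 j).
  by rewrite !mxE !hcoord_lift -c1 mul1r => ->; rewrite eqxx.
move=> F; rewrite memv_ker hom_of_linearE; split.
  move=> /eqP /rowP e s; have := e s; rewrite !mxE => <-.
  by apply: meval_eq => j; rewrite mxE.
move=> e; apply/eqP/rowP => s; rewrite !mxE -[RHS](e s).
by apply: meval_eq => j; rewrite mxE.
Qed.

(* A singular G is the limit at t = 0 of the matrices G + t, almost all of them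
   invertible. *)
Lemma smooth_frame_closure (G : 'M[k]_d) (psi : 'Hom(V, 'rV[k]_d)) :
  (forall F, psi F = point_eval F *m G) -> zariski_closure smooth_frame psi.
Proof.
move=> Hpsi; pose gamma t := psi + t *: ev.
have gammaE t F : gamma t F = point_eval F *m (G + t%:M).
  by rewrite /gamma add_lfunE scale_lfunE Hpsi hom_of_linearE mulmxDr mul_mx_scalar.
have -> : psi = gamma 0 by rewrite /gamma scale0r addr0.
pose f F j : {poly k} := (psi F 0 j)%:P + 'X * (point_eval F 0 j)%:P.
have Hf t F j : gamma t F 0 j = (f F j).[t].
  by rewrite /gamma add_lfunE scale_lfunE hom_of_linearE !mxE /f !hornerE !mxE.
apply: (frame_closure_approx char0 Hf) => r.
(* The family is its own approximation, and [char_poly (- G)] takes the value [\det (G + t%:M)] at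
   [t]. *)
exists f, gamma, (char_poly (- G)); split=> //.
- by move=> F j; rewrite subrr dvdp0.
- by rewrite monic_neq0 // char_poly_monic.
move=> t; rewrite /char_poly -horner_evalE -det_map_mx => Ht.
suff sm : smooth_frame (gamma t) by move=> P; apply.
apply: (smooth_frame_unitmx (G := G + t%:M)) => //.
rewrite unitmxE unitfE; move: Ht; congr (_ != 0); congr (\det _).
apply/matrixP => i j; rewrite !mxE /= /horner_eval hornerD hornerN hornerMn hornerX hornerC.
by rewrite opprK addrC.
Qed.

End SmoothFrames.

Definition dehom (k : fieldType) n (F : {mpoly k[n.+1]}) : {mpoly k[n]} :=
  mmap (@mpolyC n k) (hcoord (fun j => 'X_j)) F.

Section Dehomogenize.
Variables (k : fieldType) (n : nat).

Lemma dehom_linear c (F G : {mpoly k[n.+1]}) :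
  dehom (c *: F + G) = c *: dehom F + dehom G.
Proof. by rewrite /dehom mmapD mmapZ mul_mpolyC. Qed.

(** Multiplicativity of the evaluation is a hypothesis because [S] need not be commutative; this
    covers both [k] and [A]. *)
Lemma mmap_dehom (S : nzRingType) (f : {rmorphism k -> S}) (y : 'I_n -> S) F :
    {morph mmap f y : p q / p * q} ->
  mmap f y (dehom F) = mmap f (hcoord y) F.
Proof.
move=> fM; have f1 : mmap f y 1 = 1 by rewrite -mpolyC1 mmapC; apply: rmorph1.
rewrite /dehom [mmap (@mpolyC n k) _ F]/mmap raddf_sum /=; apply: eq_bigr => u _.
rewrite fM mmapC; congr (_ * _); rewrite /mmap1 (big_morph _ fM f1).
apply: eq_bigr => i _; transitivity (mmap f y (hcoord (fun j => 'X_j) i) ^+ u i).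
  by elim: (u i) => [|e IHe]; rewrite ?expr0 // !exprS fM IHe.
congr (_ ^+ _); have [j ->|->] := unliftP ord0 i.
  by rewrite !hcoord_lift mmapX mmap1U.
by rewrite !hcoord0.
Qed.

Lemma meval_dehom (y : 'I_n -> k) (F : {mpoly k[n.+1]}) :
  (dehom F).@[y] = F.@[hcoord y].
Proof. exact: (mmap_dehom (f := idfun) F (mevalM y)). Qed.

End Dehomogenize.

Section LimitFrames.
Variables (k : fieldType) (n d : nat) (w0 : 'I_d -> k) (x0 : 'I_d -> 'I_n -> k).
Hypothesis char0 : [pchar k] =i pred0.
Hypothesis distinct : forall s t, s != t -> exists j, x0 s j != x0 t j.
Hypothesis isotropic : forall b c, \sum_s w0 s * (hcoord (x0 s) b * hcoord (x0 s) c) = 0.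
Hypothesis surj : forall E, sym_tensor E ->
  exists u : 'I_d -> 'I_n.+1 -> k, forall a b c,
    \sum_s w0 s * tangent_cube (u s) (hcoord (x0 s)) a b c = E a b c.
Variable phi : {mpoly k[n]} -> k.
Hypothesis phi_linear : forall a p q, phi (a *: p + q) = a * phi p + phi q.
Hypothesis phi_high : forall u, (4 <= mdeg u)%N -> phi 'X_[u] = 0.
Variable B : 'I_d -> {mpoly k[n]}.
Local Notation V := (dhomog n.+1 k d).

Lemma frame_of_functional (f : {mpoly k[n]} -> {poly k}) :
    (forall a p q, f (a *: p + q) = a%:P * f p + f q) ->
  exists gamma : k -> 'Hom(V, 'rV[k]_d),
    forall t F j, gamma t F 0 j = (f (dehom F * B j)).[t].
Proof.
move=> fl; pose g t (F : V) : 'rV[k]_d := \row_j (f (dehom F * B j)).[t].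
have gl t : linear (g t).
  move=> c u v; apply/rowP => j; rewrite !mxE (mpoly_of_dhomog_is_linear c u v).
  by rewrite dehom_linear mulrDl -scalerAl fl hornerD hornerM hornerC.
by exists (fun t => hom_of_linear (gl t)) => t F j; rewrite hom_of_linearE mxE.
Qed.

(* A polynomial vanishing on the smooth frames vanishes on the pencil modulo
   arbitrarily large powers of t, hence identically, and phi is the member t = 1
   of the pencil. *)
Lemma limit_frame_closure (psi : 'Hom(V, 'rV[k]_d)) :
    (forall F j, psi F 0 j = phi (dehom F * B j)) ->
  zariski_closure (@smooth_frame k n d) psi.
Proof.
move=> Hpsi.
have pl := pencil_linear w0 x0 phi_linear.
have [gamma Hgamma] := frame_of_functional pl.
have -> : psi = gamma 1.
  apply/lfunP => F; apply/rowP => j; rewrite Hpsi Hgamma /pencil !hornerE.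
  by rewrite subrr mul0r add0r.
apply: (frame_closure_approx char0 Hgamma) => r.
have [w [x [Hx Happ]]] := moment_approx isotropic surj phi_linear phi_high r.
pose y s j := 'X^(r.+1) * x s j; pose X3 : {poly k} := 'X^(3 * r.+1).
have X30 : X3 != 0 by rewrite monic_neq0 ?monicXn.
(* Main term and error are both divisible by [X3], so dividing the weights by [X3] still yields
   polynomial moments. *)
have mE p : moment w y p %/ X3 * X3 = moment w y p.
  apply: divpK; rewrite -[moment _ _ _](subrK (X3 * pencil w0 x0 phi p)).
  rewrite dvdp_add ?dvdp_mulIl //; apply: dvdp_trans (Happ p).
  by rewrite dvdp_exp2l // leq_mul2r orbT.
have hl a p q : moment w y (a *: p + q) %/ X3
    = a%:P * (moment w y p %/ X3) + moment w y q %/ X3.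
  by apply: (mulIf X30); rewrite mE moment_linear mulrDl -mulrA !mE.
have [delta Hdelta] := frame_of_functional hl.
(* The factors [sep] are non-zero at the origin, where the points are the distinct [x0]. Thus [q]
   excludes the origin, where the divided weights may have a pole, and finitely many parameters
   including all collisions. *)
pose sep s t : {poly k} :=
  if [pick j | x0 s j != x0 t j] is Some j then x s j - x t j else 1.
pose q : {poly k} := 'X * \prod_s \prod_(t | t != s) sep s t.
exists (fun (F : V) (j : 'I_d) => moment w y (dehom F * B j) %/ X3), delta, q; split=> //.
- move=> F j; rewrite -(dvdp_mul2r _ _ X30) mulrBl mE [pencil _ _ _ _ * _]mulrC -exprD.
  by rewrite -[in 'X^_]mulSn.
- rewrite mulf_neq0 ?polyX_eq0 //; apply/prodf_neq0 => s _; apply/prodf_neq0 => t _.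
  rewrite /sep; case: pickP => [j Hj|_]; last exact: oner_neq0.
  apply: contra Hj => /eqP /(congr1 (horner^~ 0)).
  by rewrite hornerD hornerN !Hx horner0 => /eqP; rewrite subr_eq0.
move=> t; rewrite hornerM hornerX mulf_eq0 negb_or horner_prod => /andP [t0 /prodf_neq0 Ht].
pose yt s j := (y s j).[t].
have yt_distinct s s' : s != s' -> exists j, yt s j != yt s' j.
  move=> ss'; have := Ht s isT; rewrite horner_prod => /prodf_neq0 /(_ s').
  rewrite eq_sym => /(_ ss'); rewrite /sep; case: pickP => [j _|none].
    rewrite hornerD hornerN subr_eq0 => xj; exists j.
    rewrite /yt /y !hornerM (inj_eq (mulfI _)) // hornerXn expf_neq0 //.
  by have [j] := distinct ss'; rewrite none.
(* The moment of [dehom F * B j] is a combination of the values of [F] at the points, so the frame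
   factors through [point_eval] by a matrix, possibly singular. *)
apply: (smooth_frame_closure char0 yt_distinct
  (G := \matrix_(s, j) ((w s).[t] * (B j).@[yt s] / t ^+ (3 * r.+1)))) => F.
apply/rowP => j; rewrite Hdelta !mxE.
have X3t : X3.[t] != 0 by rewrite hornerXn expf_neq0.
apply: (mulIf X3t); rewrite -hornerM mE /moment horner_sum [RHS]mulr_suml.
apply: eq_bigr => s _; rewrite !mxE hornerM horner_mmap rmorphM /= meval_dehom.
rewrite hornerXn !mulrA divfK ?expf_neq0 //; ring.
Qed.

End LimitFrames.

(** * The point of an embedded algebra as a limit of smooth ones *)

Section Embedded.
Variables (k : fieldType) (A : falgType k).
Hypothesis A_comm : commutative (@GRing.mul A).
Variables (n : nat) (x : 'I_n -> A).
Hypotheses (x_emb : affine_embedding x)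
  (x_high : forall u, (4 <= mdeg u)%N -> mmap1 x u = 0)
  (dim_ge3 : (3 <= \dim {: A})%N).
Variable lam : {linear A -> k^o}.
Hypothesis lam_nondeg : forall a, (forall b, lam (a * b) = 0) -> a = 0.

Local Notation d := (\dim {: A}).
Local Notation V := (dhomog n.+1 k d).

Definition algebra_eval (F : V) : A := mmap (in_alg A) (homog_coord x) (F : {mpoly k[n.+1]}).

Fact algebra_eval_linear : linear algebra_eval.
Proof.
move=> c u v; rewrite /algebra_eval (mpoly_of_dhomog_is_linear c u v).
by rewrite mmapD mmapZ /= mulr_algl.
Qed.

Let ev := hom_of_linear algebra_eval_linear.

(** Monomials of degree at least 4 vanish in [A]; the others are homogenised by a power of
    coordinate 0, which evaluates to 1. This needs [d] to be at least 3. *)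
Lemma algebra_eval_surj a : exists F, algebra_eval F = a.
Proof.
have [p <-] := x_emb a.
elim/mpolyind: p => [|c u p _ _ [F HF]].
  by exists 0; rewrite /algebra_eval /= !mmap0.
suff [G HG] : exists G, algebra_eval G = mmap1 x u.
  by exists (c *: G + F); rewrite algebra_eval_linear HG HF mmapD mmapZ mmapX /= mulr_algl.
have [/x_high ->|u3] := leqP 4 (mdeg u); first by exists 0; rewrite /algebra_eval /= mmap0.
pose u' := [multinom (if unlift ord0 i is Some j then u j else d - mdeg u)%N | i < n.+1].
have u'hom : 'X_[u'] \is [in k[n.+1], d.-homog].
  rewrite dhomogX /= mdegE big_ord_recl /= mnmE unlift_none.
  under eq_bigr do rewrite mnmE liftK.
  by rewrite -mdegE subnK // (leq_trans _ dim_ge3).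
exists (DHomog u'hom); rewrite /algebra_eval /= mmapX /mmap1 big_ord_recl.
rewrite /homog_coord unlift_none expr1n mul1r.
by apply: eq_bigr => i _; rewrite liftK mnmE liftK.
Qed.

(** [psi] pairs [F] with a basis of [A] through [lam]. By nondegeneracy its kernel is that of
    evaluation in [A], so it is a frame of the point of [Spec A], and [limit_frame_closure] applies
    to it. *)
Lemma embedded_smoothable (char0 : [pchar k] =i pred0)
    (w0 : 'I_d -> k) (x0 : 'I_d -> 'I_n -> k) :
    (forall s t, s != t -> exists j, x0 s j != x0 t j) ->
    (forall b c, \sum_s w0 s * (hcoord (x0 s) b * hcoord (x0 s) c) = 0) ->
    (forall E, sym_tensor E -> exists u : 'I_d -> 'I_n.+1 -> k, forall a b c,
       \sum_s w0 s * tangent_cube (u s) (hcoord (x0 s)) a b c = E a b c) ->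
  smoothable A.
Proof.
move=> distinct isotropic surj.
exists n, x, (lker ev); split=> // [F|].
  by rewrite memv_ker hom_of_linearE; split=> /eqP.
pose e (j : 'I_d) := (vbasis {: A})`_j.
have [B HB] : exists B : 'I_d -> {mpoly k[n]}, forall j, mmap (in_alg A) x (B j) = e j.
  exact: (fin_all_exists (fun j : 'I_d => x_emb (e j))).
pose phi p : k := lam (mmap (in_alg A) x p).
have phi_linear a p q : phi (a *: p + q) = a * phi p + phi q.
  by rewrite /phi mmapD mmapZ /= mulr_algl linearP.
have phi_high u : (4 <= mdeg u)%N -> phi 'X_[u] = 0.
  by move=> /x_high u0; rewrite /phi mmapX u0 linear0.
pose g (F : V) : 'rV[k]_d := \row_j lam (algebra_eval F * e j).
have gl : linear g.
  move=> c u v; apply/rowP => j; rewrite !mxE algebra_eval_linear mulrDl -scalerAl.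
  by rewrite linearP.
pose psi := hom_of_linear gl.
have lk : lker psi = lker ev.
  apply/vspaceP => F; rewrite !memv_ker !hom_of_linearE.
  apply/eqP/eqP => [/rowP HF|HF]; last first.
    by apply/rowP => j; rewrite !mxE HF mul0r linear0.
  apply: lam_nondeg => b; rewrite (coord_vbasis (memvf b)) mulr_sumr linear_sum big1 // => j _.
  by rewrite -scalerAr linearZ /=; have := HF j; rewrite !mxE => ->; rewrite scaler0.
exists psi; split.
  split=> //; apply/eqP; rewrite eqEdim subvf.
  have evf : limg ev = fullv.
    apply/eqP; rewrite eqEsubv subvf; apply/subvP => a _.
    have [F <-] := algebra_eval_surj a.
    by rewrite -[algebra_eval F](hom_of_linearE algebra_eval_linear) memv_img ?memvf.
  (* Having the same kernel, [psi] and [ev] have the same rank. *)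
  have := limg_ker_dim psi fullv; have := limg_ker_dim ev fullv.
  rewrite !capfv lk evf => e1 e2.
  have /addnI -> := etrans e2 (esym e1).
  by rewrite dimvf /dim /= mul1n leqnn.
apply: (limit_frame_closure char0 distinct isotropic surj phi_linear phi_high (B := B)).
move=> F j; rewrite hom_of_linearE mxE /phi commutative_mmapM // HB.
by rewrite mmap_dehom //; apply: commutative_mmapM.
Qed.

End Embedded.

Theorem theorem1 (k : closedFieldType) (char0 : [pchar k] =i pred0)
    (A : falgType k) (A_comm : commutative (@GRing.mul A))
    (m : {vspace A}) (A_local : is_local m) (A_gor : gorenstein A)
    (A_hilb : forall n : nat, hilb_fun m n = nth 0%N [:: 1; 5; 5; 1]%N n) :
  smoothable A.
Proof.
have mi := local_ideal A_local.
have decr := ideal_pow_decr m A_comm.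
(* The Hilbert function at 4 is the default value 0 of [nth]; hence [m^5 = m^4], and Nakayama's
   lemma applies. *)
have m4 : ideal_pow m 4 = 0%VS.
  have e45 : ideal_pow m 5 = ideal_pow m 4.
    apply/eqP; rewrite eqEdim decr /=.
    by have := A_hilb 4; rewrite /hilb_fun => /eqP; rewrite subn_eq0.
  have sub : (ideal_pow m 4 <= ideal_pow m 4 * m)%VS by rewrite -[X in (_ <= X)%VS]/(ideal_pow m 5) e45.
  exact (nakayama A_comm A_local (@ideal_pow_ideal _ _ m 4) sub).
have hilb n : \dim (ideal_pow m n) = (nth 0 [:: 1; 5; 5; 1] n + \dim (ideal_pow m n.+1))%N.
  by rewrite -A_hilb /hilb_fun subnK // dimvS.
(* The value 1 of the Hilbert function at 0 says that the residue field is [k]. *)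
have dim_m : \dim {: A} = (\dim m).+1.
  by rewrite -[fullv]/(ideal_pow m 0) hilb ideal_pow1.
have dim12 : \dim {: A} = 12.
  by rewrite -[fullv]/(ideal_pow m 0) (hilb 0) (hilb 1) (hilb 2) (hilb 3) m4 dimv0.
have [x x_emb xm] : exists2 x : 'I_5 -> A, affine_embedding x & forall i, x i \in m.
  apply: (local_generators_exist A_comm A_local dim_m m4).
  by rewrite -{1}(ideal_pow1 mi) -/(hilb_fun m 1) A_hilb.
have [lam lamP] := gorenstein_functional A_comm A_local A_gor dim_m m4.
have x_high u : (4 <= mdeg u)%N -> mmap1 x u = 0.
  move=> u4; apply/eqP; rewrite -memv0 -m4.
  have := mmap1_ideal_pow A_comm u xm; apply/subvP.
  elim: (mdeg u) u4 => // e IHe; rewrite leq_eqVlt => /orP [/eqP<- //|/IHe].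
  exact/subv_trans/decr.
have : exists (w : 'I_(\dim {: A}) -> k) (x : 'I_(\dim {: A}) -> 'I_5 -> k),
  [/\ forall s t, s != t -> exists j, x s j != x t j,
      forall b c, \sum_s w s * (hcoord (x s) b * hcoord (x s) c) = 0 &
      forall E, sym_tensor E -> exists u : 'I_(\dim {: A}) -> 'I_6 -> k, forall a b c,
        \sum_s w s * tangent_cube (u s) (hcoord (x s)) a b c = E a b c].
  rewrite dim12; exact: isotropic_configuration.
case=> w [x0 [distinct isotropic surj]].
by apply: (embedded_smoothable A_comm x_emb x_high _ lamP char0 distinct isotropic surj); rewrite dim12.
Qed.
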